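(* Let $n\ge 2$ and let $\Omega\subset\mathbb{R}^n$ be a bounded $(\alpha,\beta)$-John domain. Suppose that $\delta\in(0,n]$, $\kappa\in[0,1)$ and $p\in(\delta/n,\delta)$. Then there exists a constant $c$ depending only on $n$, $\delta$, $\kappa$, $p$, $\alpha$ and $\beta$ such that $$\inf_{b\in\mathbb{R}}\Big(\int_\Omega|u(x)-b|^{\frac{p(\delta-\kappa p)}{\delta-p}}\,d\mathcal{H}^{\delta-\kappa p}_\infty\Big)^{\frac{\delta-p}{p(\delta-\kappa p)}}\le c\Big(\int_\Omega|\nabla u(x)|^p\,d\mathcal{H}^\delta_\infty\Big)^{\frac1p}$$ for all $u\in C^1(\Omega)$.
   Context: A domain is an open, connected set in $\mathbb{R}^n$, $n\ge 2$. For $\delta\in(0,n]$ and $E\subset\mathbb{R}^n$, the $\delta$-dimensional Hausdorff content is $$\mathcal{H}^\delta_\infty(E):=\inf\Big\{\sum_{i} r_i^\delta : E\subset\bigcup_{i}B(x_i,r_i)\Big\},$$ the infimum being taken over all finite or countable coverings of $E$ by open balls $B(x_i,r_i)$. For $f:\Omega\to[0,\infty]$ the Choquet integral with respect to $\mathcal{H}^\delta_\infty$ is $$\int_\Omega f(x)\,d\mathcal{H}^\delta_\infty:=\int_0^\infty\mathcal{H}^\delta_\infty(\{x\in\Omega: f(x)>t\})\,dt .$$ A bounded domain $\Omega\subset\mathbb{R}^n$ is an $(\alpha,\beta)$-John domain, $0<\alpha\le\beta<\infty$, if there is a point $x_0\in\Omega$ such that each $x\in\Omega$ can be joined to $x_0$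 by a rectifiable curve $\gamma_x:[0,\ell(\gamma_x)]\to\Omega$, parametrized by arc length, with $\gamma_x(0)=x$, $\gamma_x(\ell(\gamma_x))=x_0$, $\ell(\gamma_x)\le\beta$, and $\operatorname{dist}(\gamma_x(t),\partial\Omega)\ge\frac{\alpha}{\beta}t$ for all $t\in[0,\ell(\gamma_x)]$. $C^1(\Omega)$ denotes the continuously differentiable real-valued functions on $\Omega$. Integrals may take the value $\infty$. *)

(* Defs.v *)
From HB Require Import structures.
From mathcomp Require Import all_boot all_order all_algebra.
From mathcomp Require Import all_classical all_reals all_analysis.

Set Implicit Arguments.
Unset Strict Implicit.
Unset Printing Implicit Defensive.

Import Order.TTheory GRing.Theory Num.Theory.
Import numFieldNormedType.Exports.

Local Open Scope classical_set_scope.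
Local Open Scope ring_scope.
Local Open Scope ereal_scope.

(* The library norm on 'rV[R]_n is the sup norm; it induces the usual topology
   of R^n, but lengths, distances, balls and gradients below are Euclidean. *)
Definition enorm (R : realType) (n : nat) (x : 'rV[R]_n) : R :=
  Num.sqrt (\sum_(i < n) x ord0 i ^+ 2)%R.

Definition eball (R : realType) (n : nat) (x : 'rV[R]_n) (r : R)
    : set 'rV[R]_n :=
  [set y | (enorm (y - x) < r)%R].

(* Valued in \bar R so that the distance to the empty set is +oo. *)
Definition edist_set (R : realType) (n : nat) (x : 'rV[R]_n)
    (A : set 'rV[R]_n) : \bar R :=
  ereal_inf [set (enorm (x - y))%:E | y in A].

Definition boundary (T : topologicalType) (A : set T) : set T :=
  closure A `\` interior A.

(* A finite or countable covering is a family indexed by a subset D of nat. *)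
Definition hausdorff_content (R : realType) (n : nat) (delta : R)
    (E : set 'rV[R]_n) : \bar R :=
  ereal_inf [set s | exists (D : set nat) (x : nat -> 'rV[R]_n) (r : nat -> R),
    [/\ forall i, D i -> (0 < r i)%R,
        E `<=` \bigcup_(i in D) eball (x i) (r i) &
        s = \esum_(i in D) (r i `^ delta)%:E]].

Definition choquet_integral (R : realType) (n : nat) (delta : R)
    (Omega : set 'rV[R]_n) (f : 'rV[R]_n -> \bar R) : \bar R :=
  \int[@lebesgue_measure R]_(t in `[0%R, +oo[)
    hausdorff_content delta [set x | Omega x /\ t%:E < f x].

(* The sum is over the consecutive pairs of the subdivision a :: s of [a, b]. *)
Definition curve_length (R : realType) (n : nat) (a b : R)
    (gamma : R -> 'rV[R]_n) : \bar R :=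
  ereal_sup [set (\sum_(xy <- zip (a :: s) s)
                    enorm (gamma xy.2 - gamma xy.1))%R%:E |
             s in itv_partition a b].

(* A rectifiable curve of length l parametrized by arc length is a curve on
   [0, l] whose restriction to each [0, t] has length t. *)
Definition arc_length_curve (R : realType) (n : nat) (l : R)
    (gamma : R -> 'rV[R]_n) : Prop :=
  [/\ (0 <= l)%R, {within `[0%R, l], continuous gamma} &
      forall t : R, t \in `[0%R, l] -> curve_length 0 t gamma = t%:E].

Definition domain (R : realType) (n : nat) (Omega : set 'rV[R]_n) : Prop :=
  open Omega /\ connected Omega.

Definition john_domain (R : realType) (n : nat) (alpha beta : R)
    (Omega : set 'rV[R]_n) : Prop :=
  [/\ domain Omega, bounded_set Omega &
      exists2 x0, Omega x0 & forall x, Omega x ->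
        exists (l : R) (gamma : R -> 'rV[R]_n),
          [/\ arc_length_curve l gamma,
              forall t, t \in `[0%R, l] -> Omega (gamma t),
              gamma 0%R = x /\ gamma l = x0,
              (l <= beta)%R &
              forall t, t \in `[0%R, l] ->
                (alpha / beta * t)%:E
                  <= edist_set (gamma t) (boundary Omega)]].

Definition gradient (R : realType) (n : nat) (u : 'rV[R]_n -> R)
    (x : 'rV[R]_n) : 'rV[R]_n :=
  \row_(i < n) 'D_(delta_mx ord0 i) u x.

(* Only the values of u on the open set Omega matter. *)
Definition C1_on (R : realType) (n : nat) (Omega : set 'rV[R]_n)
    (u : 'rV[R]_n -> R) : Prop :=
  (forall x, Omega x -> differentiable u x) /\
  {within Omega, continuous (gradient u)}.

(* Main.v *)
Require Import Defs.
From HB Require Import structures.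
From mathcomp Require Import all_boot all_order all_algebra.
From mathcomp Require Import all_classical all_reals all_analysis.
From mathcomp Require Import measurable_realfun ring lra zify.

(** For a John domain the classical route to such an inequality bounds
[|u x - b|] by a Riesz potential of the gradient, and the potential by a
fractional maximal function, whose boundedness on Choquet spaces comes from
covering arguments. The proof below follows the same route without Lebesgue
measure on [R ^ n]: volumes are counted on fine finite lattices, and all
quantities are discretized at powers of two.

Put [f = |grad u|], [s = delta - kappa p] and [q = p s / (delta - p)]. If the
energy of [f] is less than [W], the superlevel sets [f > 2 ^ k] are covered by
balls such that the sum over all levels of [2 ^ (p k) r ^ delta] is at most a
multiple of [W] ([efficient_cover]).

Fix an exponent [p1] strictly between [delta / n] and [p]. A dyadic cell of side
[l = 2 ^ a] is heavy for the size [2 ^ m] if, for some level [k] with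
[2 ^ m l ^ (- kappa) <= 2 ^ k], the balls of that level centered in it weigh at
least [l ^ delta (2 ^ m l ^ (- kappa) / 2 ^ k) ^ p1]. The points near a heavy
cell play the role of the set where the fractional maximal function of [f]
exceeds [2 ^ m]. The maximal heavy cells of one level and one [m] are disjoint,
so the weights of the balls pay for them, and as [p1 < p] a ball pays for all
values of [m] together only a geometric series: the contents of these sets,
weighted by [2 ^ (p m)], add up to a multiple of [W]
([sum_content_near_heavy]). This is the strong type inequality for the
fractional maximal function.

At a point [x] near no heavy cell, the part of a cube of side [2 ^ a] near [x]
lying in [f > 2 ^ k] has density at most a power, larger than one because
[p1 > delta / n], of [2 ^ (theta - k)], where [2 ^ theta] is the smaller of the
two sizes [2 ^ m 2 ^ (- kappa a)] and [(W 2 ^ (- delta a)) ^ (1 / p)]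
([lattice_density]). Hence the mean of [f] over that cube is at most a multiple
of [2 ^ theta].

A John curve from [x] to the center [x0] is surrounded by cubes with sides
proportional to the distance run. The mean of [u] over the cube at time [t]
tends to [u x] as [t] tends to [0] and does not depend on [x] at the other end;
moving a whole lattice of points along the curve at once, its variation is
controlled by means of [f] ([block_oscillation]). Summing over the dyadic
blocks, the two bounds on [2 ^ theta] give two geometric series, decaying
because [kappa < 1] and because [p < delta], and their balance is Hedberg's
inequality: up to constants, [|u x - b| ^ q <= W ^ (q / p - 1) 2 ^ (p m)]
([point_oscillation]). So [|u - b| ^ q] exceeds the right-hand side only near
heavy cells for [m], and the sum of the contents of these sets bounds the
Choquet integral of [|u - b| ^ q] by a multiple of [W ^ (q / p)]. *)

Set Implicit Arguments.
Unset Strict Implicit.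
Unset Printing Implicit Defensive.

Import Order.TTheory GRing.Theory Num.Theory.
Import numFieldNormedType.Exports.

Local Open Scope classical_set_scope.
Local Open Scope ring_scope.

(** * Powers of two and geometric sums *)

Definition pow2 (R : realType) (x : R) : R := 2 `^ x.

Lemma pow2_gt0 (R : realType) (x : R) : 0 < pow2 x.
Proof. exact/powR_gt0. Qed.

Lemma pow2_ge0 (R : realType) (x : R) : 0 <= pow2 x.
Proof. exact/powR_ge0. Qed.

Lemma pow2D (R : realType) (x y : R) : pow2 (x + y) = pow2 x * pow2 y.
Proof. by rewrite /pow2 powRD// pnatr_eq0 implybT. Qed.

Lemma pow2B (R : realType) (x y : R) : pow2 (x - y) = pow2 x / pow2 y.
Proof. by rewrite pow2D /pow2 powRN. Qed.

Lemma pow2N (R : realType) (x : R) : pow2 (- x) = (pow2 x)^-1.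
Proof. by rewrite /pow2 powRN. Qed.

Lemma pow20 (R : realType) : pow2 (0 : R) = 1.
Proof. exact: powRr0. Qed.

Lemma pow21 (R : realType) : pow2 (1 : R) = 2.
Proof. by rewrite /pow2 powRr1. Qed.

Lemma pow22 (R : realType) : pow2 2 = 4 :> R.
Proof. by rewrite (_ : 2 = 1 + 1 :> R)// pow2D pow21; ring. Qed.

Lemma pow2_powR (R : realType) (x y : R) : pow2 x `^ y = pow2 (x * y).
Proof. by rewrite /pow2 powRrM. Qed.

Lemma pow2_le (R : realType) (x y : R) : (pow2 x <= pow2 y) = (x <= y).
Proof.
apply/idP/idP => [|xy]; last by rewrite /pow2 ler_powR// ler1n.
apply: contraLR; rewrite -!ltNge => yx.
rewrite -(subrK y x) pow2D ltr_pMl ?pow2_gt0// /pow2.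
have xy0 : 0 < x - y by rewrite subr_gt0.
have one : (1 : R) `^ (x - y) = 1 by rewrite powR1.
by rewrite -[ltLHS]one gt0_ltr_powR// ?nnegrE//= ltr1n.
Qed.

Lemma pow2_lt (R : realType) (x y : R) : (pow2 x < pow2 y) = (x < y).
Proof. by rewrite !ltNge pow2_le. Qed.

Lemma pow2_ge1 (R : realType) (x : R) : (1 <= pow2 x) = (0 <= x).
Proof. by rewrite -pow20 pow2_le. Qed.

Lemma pow2_le1 (R : realType) (x : R) : (pow2 x <= 1) = (x <= 0).
Proof. by rewrite -pow20 pow2_le. Qed.

Lemma pow2_lt1 (R : realType) (x : R) : (pow2 x < 1) = (x < 0).
Proof. by rewrite -pow20 pow2_lt. Qed.

Lemma pow2_log (R : realType) (w : R) : 0 < w -> exists x, w = pow2 x.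
Proof.
move=> w0; exists (ln w / ln 2).
have ln20 : ln (2 : R) != 0 by rewrite gt_eqF// ln_gt0// ltr1n.
by rewrite /pow2 /powR pnatr_eq0/= divfK// lnK.
Qed.

Lemma pow2_round (R : realType) (r : R) : 0 < r ->
  exists b : int, r <= pow2 b%:~R /\ pow2 b%:~R <= 2 * r.
Proof.
move=> /pow2_log[x ->]; exists (Num.floor x + 1).
have /andP[h1 h2] := floor_itv x.
rewrite -pow21 -pow2D !pow2_le ltW//; split=> //.
by rewrite intrD addrC lerD2l.
Qed.

Lemma pow2_unbounded (R : realType) (v : R) : exists k : nat, v < pow2 k%:R.
Proof.
have [v0|v0] := leP v 0; first by exists 0%N; rewrite (le_lt_trans v0)// pow2_gt0.
have [b [h1 _]] := pow2_round v0.
exists (`|b|.+1)%N; rewrite (le_lt_trans h1)// pow2_lt.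
by rewrite (le_lt_trans (ler_norm _))// -intr_norm -abszE -natr1 ltrDl.
Qed.

Lemma pow2_small (R : realType) (e : R) : 0 < e -> exists k : nat, pow2 (- k%:R) < e.
Proof.
move=> e0; have [k hk] := pow2_unbounded e^-1.
by exists k; rewrite pow2N -[ltRHS]invrK ltf_pV2 ?posrE ?invr_gt0 ?pow2_gt0.
Qed.

(** The two-sided geometric sum telescopes: its terms are dominated by the
increments of a bounded function, whatever the position of [z]. *)
Lemma pow2_two_sided_step (R : realType) (e z : R) : 0 < e ->
  let psi := fun t => if t < 0 then pow2 (e * t) else 2 - pow2 (- (e * t)) in
  pow2 (- (e * `|z|)) * (1 - pow2 (- e)) <= psi (z + 1) - psi z.
Proof.
move=> e0 /=.
have r0 := pow2_gt0 (- e).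
have r1 : pow2 (- e) < 1 by rewrite pow2_lt1 oppr_lt0.
case: (ltP z 0) => z0; case: (ltP (z + 1) 0) => z1.
- rewrite ltr0_norm// mulrN opprK [e * (z + 1)]mulrDr mulr1 pow2D.
  rewrite -[in X in _ * X - _](opprK e) [pow2 (- - e)]pow2N.
  have h : 1 <= (pow2 (- e))^-1 by rewrite invf_ge1// ltW.
  have hz := pow2_gt0 (e * z).
  have -> : pow2 (e * z) / pow2 (- e) - pow2 (e * z) =
     pow2 (e * z) * ((pow2 (-e))^-1 - 1) by rewrite mulrBr mulr1.
  rewrite ler_pM2l// -subr_ge0.
  set r := pow2 (- e) in r0 r1 h *; set s := r^-1 in h *.
  have rs : r * s = 1 by rewrite divff// gt_eqF.
  nra.
- rewrite ltr0_norm// mulrN opprK [e * (z + 1)]mulrDr mulr1.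
  set X := pow2 (- (_ + _)); set Y := pow2 (e * z).
  have XY : X * Y = pow2 (- e) by rewrite /X /Y -pow2D; congr pow2; ring.
  have X1 : X <= 1 by rewrite /X pow2_le1; nra.
  have Y1 : Y <= 1 by rewrite /Y pow2_le1; nra.
  have X0 : 0 < X := pow2_gt0 _.
  have Y0 : 0 < Y := pow2_gt0 _.
  rewrite -XY; rewrite -XY in r1 r0. nra.
- exfalso; lra.
- rewrite ger0_norm// [e * (z + 1)]mulrDr mulr1 opprD pow2D.
  lra.
Qed.

(** The bound does not depend on the center [t], which need not be an integer. *)
Lemma sum_pow2_two_sided_range (R : realType) (e : R) : 0 < e ->
  exists2 C : R, 0 < C & forall (t : R) (k0 : R) N,
    \sum_(0 <= i < N) pow2 (- (e * `|k0 + i%:R - t|)) <= C.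
Proof.
move=> e0; have r1 : pow2 (- e) < 1 by rewrite pow2_lt1 oppr_lt0.
have r10 : 0 < 1 - pow2 (- e) by rewrite subr_gt0.
exists (2 / (1 - pow2 (- e))); first exact: divr_gt0.
move=> t k0 N; rewrite ler_pdivlMr// mulr_suml.
pose psi (t : R) := if t < 0 then pow2 (e * t) else 2 - pow2 (- (e * t)).
have psi0 x : 0 <= psi x <= 2.
  rewrite /psi; case: ltP => x0.
    rewrite pow2_ge0/= (@le_trans _ _ 1)// ?ler1n// pow2_le1; nra.
  have h := pow2_gt0 (- (e * x)).
  have h1 : pow2 (- (e * x)) <= 1 by rewrite pow2_le1; nra.
  apply/andP; split; lra.
apply: (@le_trans _ _ (\sum_(0 <= i < N) (psi (k0 + i.+1%:R - t) - psi (k0 + i%:R - t)))).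
  apply: ler_sum => i _.
  have := pow2_two_sided_step (k0 + i%:R - t) e0.
  rewrite /= -/(psi _) -/(psi _) => /le_trans; apply.
  by rewrite -natr1 !addrA [_ - t + 1]addrAC.
rewrite telescope_sumr//.
have /andP[_ h1] := psi0 (k0 + N%:R - t).
have /andP[h2 _] := psi0 (k0 + 0%:R - t).
lra.
Qed.

Lemma sum_pow2_two_sided (R : realType) (e : R) : 0 < e ->
  exists2 C : R, 0 < C & forall (t : R) (F : seq int), uniq F ->
    \sum_(k <- F) pow2 (- (e * `|k%:~R - t|)) <= C.
Proof.
move=> e0; have [C C0 hC] := sum_pow2_two_sided_range e0.
exists C => // t F uF.
pose B := (\max_(k <- F) `|k|)%N.
apply: le_trans (hC t (- B%:R) (B.*2.+1)).
have -> : \sum_(0 <= i < B.*2.+1) pow2 (- (e * `|- B%:R + i%:R - t|)) =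
   \sum_(k <- [seq i%:Z - B%:Z | i <- index_iota 0 B.*2.+1]) pow2 (- (e * `|k%:~R - t|)).
  rewrite big_map; apply: eq_bigr => i _.
  by congr (pow2 (- (e * `|_|))); rewrite intrB -!pmulrn; ring.
rewrite -/(index_iota _ _).
set G := [seq _ | i <- _].
have uG : uniq G by rewrite map_inj_uniq ?iota_uniq// => i j; lia.
have FG k : k \in F -> k \in G.
  move=> kF; apply/mapP; exists (absz (k + B%:Z)).
    rewrite mem_index_iota.
    have : (absz k <= B)%N by exact: (@leq_bigmax_seq _ F xpredT (fun k : int => absz k)).
    by rewrite -addnn; lia.
  have : (absz k <= B)%N by exact: (@leq_bigmax_seq _ F xpredT (fun k : int => absz k)).
  by lia.
rewrite [leRHS](bigID (mem F))/=.
have -> : \sum_(k <- F) pow2 (- (e * `|k%:~R - t|)) =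
          \sum_(k <- G | k \in F) pow2 (- (e * `|k%:~R - t|)).
  rewrite -[RHS]big_filter; apply: perm_big; apply: uniq_perm => //.
    exact: filter_uniq.
  by move=> k; rewrite mem_filter; case kF : (k \in F) => //=; rewrite FG.
by rewrite lerDl sumr_ge0// => *; exact: pow2_ge0.
Qed.

(** * Dyadic sums for Choquet integrals *)

Lemma nonincreasing_emeasurable (R : realType) (D : set R) (G : R -> \bar R) :
  measurable D -> (forall s t, s <= t -> (G t <= G s)%E) -> measurable_fun D G.
Proof.
move=> mD Gni; apply: (measurability _ (ErealGenOInfty.measurableE R)).
move=> _ /= [_ [r ->] <-]; apply: measurableI => //.
apply: is_interval_measurable => s t /=.
rewrite !in_itv/= !andbT => Gs Gt u /andP[su ut].
by rewrite in_itv/= andbT (lt_le_trans Gt)// Gni.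
Qed.

Lemma pos_real_int_range (R : realType) (c p x : R) : 0 < c -> 0 < p -> 0 < x ->
  exists k : int, c * pow2 (p * k%:~R) < x <= c * pow2 (p * (k%:~R + 1)).
Proof.
move=> c0 p0 x0.
have /pow2_log[y xy] : 0 < x / c by exact: divr_gt0.
have -> : x = c * pow2 y by rewrite -xy mulrC divfK// gt_eqF.
exists (- Num.floor (- (y / p)) - 1).
rewrite ltr_pM2l// ler_pM2l// pow2_lt pow2_le.
have /andP[] := floor_itv (- (y / p)).
rewrite !intrD mulrNz => h1 h2.
have hy : y = p * (y / p) by rewrite mulrC divfK// gt_eqF.
move: (y / p) hy h1 h2 => a -> h1 h2.
rewrite ltr_pM2l// ler_pM2l//.
by apply/andP; split; lra.
Qed.

Definition dyadic_itv (R : realType) (c p : R) (k : int) : set R :=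
  `]c * pow2 (p * k%:~R), c * pow2 (p * (k%:~R + 1))]%classic.

Lemma measurable_dyadic_itv (R : realType) (c p : R) (k : int) :
  measurable (dyadic_itv c p k).
Proof. exact: measurable_itv. Qed.

Lemma lebesgue_measure_dyadic_itv (R : realType) (c p : R) (k : int) :
  0 < c -> 0 < p -> lebesgue_measure (dyadic_itv c p k) =
  (c * pow2 (p * (k%:~R + 1)) - c * pow2 (p * k%:~R))%:E.
Proof.
move=> c0 p0; rewrite /dyadic_itv lebesgue_measure_itv/= lte_fin ltr_pM2l// pow2_lt.
by rewrite ifT ?ltr_pM2l ?ltrDl.
Qed.

Lemma integral_cst_dyadic_itv (R : realType) (c p : R) (k : int) (y : \bar R) :
  0 < c -> 0 < p ->
  (\int[@lebesgue_measure R]_(t in dyadic_itv c p k) cst y t =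
   (c * pow2 (p * (k%:~R + 1)) - c * pow2 (p * k%:~R))%R%:E * y)%E.
Proof.
move=> c0 p0; rewrite integral_cst; last exact: measurable_dyadic_itv.
by rewrite muleC; congr (_ * _)%E; exact: lebesgue_measure_dyadic_itv.
Qed.

(** Monotonicity of [G] makes it measurable on every interval, so nothing else is
needed to cut the half-line at the points [c * 2 ^ (p * k)]. *)
Lemma integral_dyadic_split (R : realType) (c p : R) (G : R -> \bar R) :
  0 < c -> 0 < p -> (forall s t, s <= t -> (G t <= G s)%E) ->
  (forall t, (0 <= G t)%E) ->
  (\int[@lebesgue_measure R]_(t in `[0%R, +oo[) G t =
   \esum_(k in [set: int]) \int[@lebesgue_measure R]_(t in dyadic_itv c p k) G t)%E.
Proof.
move=> c0 p0 Gni G0.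
have mG D : measurable D -> measurable_fun D G.
  by move=> mD; exact: nonincreasing_emeasurable.
pose J := dyadic_itv c p.
pose F (i : nat) := if pickle_inv (i) is Some k then J k else set0.
rewrite -integral_itv_obnd_cbnd; last exact: mG.
have -> : `]0%R, +oo[%classic = \bigcup_i F i.
  apply/seteqP; split=> x /=.
    rewrite in_itv/= andbT => x0.
    have [k hk] := pos_real_int_range c0 p0 x0.
    exists (pickle k); first exact: I.
    by rewrite /F pickleK_inv /J /dyadic_itv; rewrite /= in_itv; exact: hk.
  case=> i _; rewrite /F; case: pickle_inv => //= k.
  rewrite /J/dyadic_itv/= !in_itv/= andbT => /andP[h _]; apply: le_lt_trans h.
  by rewrite mulr_ge0// ?pow2_ge0// ltW.
have mF i : measurable (F i) by rewrite /F; case: pickle_inv => //= k; exact: measurable_itv.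
rewrite ge0_integral_bigcup//=; last 2 first.
- by apply: mG; exact: bigcup_measurable.
- move=> i j _ _ [x []]; rewrite /F.
  have := @pickle_invK int i; have := @pickle_invK int j.
  case: pickle_inv => //= k <-; case: pickle_inv => //= l <-.
  rewrite /J/dyadic_itv/= !in_itv/= => /andP[h1 h2] /andP[h3 h4].
  have h5 := lt_le_trans h1 h4; have h6 := lt_le_trans h3 h2.
  congr pickle; move: h5 h6; rewrite !ltr_pM2l// !pow2_lt !ltr_pM2l//.
  rewrite -!(intrD _ _ 1) !ltr_int; lia.
rewrite nneseries_esum; last by move=> i _; exact: integral_ge0.
rewrite (_ : [set x | xpredT x] = setT); last by apply/seteqP; split.
rewrite (@esumID _ _ (pickle @` [set: int])); last by move=> i _; exact: integral_ge0.
rewrite [X in (_ + X)%E]esum1 ?adde0; last first.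
  move=> i [_ hi]; rewrite /F; case E : pickle_inv => [k|]; last by rewrite integral_set0.
  by exfalso; apply: hi; exists k => //; have := @pickle_invK int i; rewrite E.
rewrite setTI esum_image; last by move=> k l _ _ /(pcan_inj pickleK).
by apply: eq_esum => k _; rewrite /F pickleK_inv.
Qed.

Lemma dyadic_sum_le_integral (R : realType) (p : R) (G : R -> \bar R) :
  0 < p -> (forall s t, s <= t -> (G t <= G s)%E) -> (forall t, (0 <= G t)%E) ->
  (\esum_(k in [set: int]) ((pow2 (p * k%:~R) * (1 - pow2 (- p)))%R%:E * G (pow2 (p * k%:~R)))
   <= \int[@lebesgue_measure R]_(t in `[0%R, +oo[) G t)%E.
Proof.
move=> p0 Gni G0.
rewrite (@integral_dyadic_split _ (pow2 (- p)) p)// ?pow2_gt0//.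
apply: le_esum => k _.
have := @integral_cst_dyadic_itv R (pow2 (- p)) p k (G (pow2 (p * k%:~R))) (pow2_gt0 _) p0.
rewrite -!pow2D.
have -> : - p + p * (k%:~R + 1) = p * k%:~R by ring.
have -> : (pow2 (p * k%:~R) * (1 - pow2 (- p)))%:E =
  (pow2 (p * k%:~R) - pow2 (- p + p * k%:~R))%:E.
  by rewrite pow2D; congr EFin; ring.
move=> <-.
apply: ge0_le_integral => //.
- exact: measurable_dyadic_itv.
- by move=> *; exact: G0.
- by apply: nonincreasing_emeasurable => //; exact: measurable_dyadic_itv.
- move=> x; rewrite /dyadic_itv/= in_itv/= => /andP[_ h]; apply: Gni.
  apply: (le_trans h); rewrite -pow2D pow2_le.
  have -> : - p + p * (k%:~R + 1) = p * k%:~R by ring.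
  exact: lexx.
Qed.

Lemma integral_le_dyadic_sum (R : realType) (c p : R) (G : R -> \bar R) :
  0 < c -> 0 < p -> (forall s t, s <= t -> (G t <= G s)%E) -> (forall t, (0 <= G t)%E) ->
  (\int[@lebesgue_measure R]_(t in `[0%R, +oo[) G t <=
  \esum_(k in [set: int]) ((c * pow2 p * pow2 (p * k%:~R))%R%:E * G (c * pow2 (p * k%:~R))%R))%E.
Proof.
move=> c0 p0 Gni G0.
rewrite (@integral_dyadic_split _ c p)// ?pow2_gt0//.
apply: le_esum => k _.
have := @integral_cst_dyadic_itv R c p k (G (c * pow2 (p * k%:~R))) c0 p0.
move=> h; apply: (@le_trans _ _ (\int[lebesgue_measure]_(t in dyadic_itv c p k) cst (G (c * pow2 (p * k%:~R))%R) t)%E).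
  apply: ge0_le_integral => //.
  - exact: measurable_dyadic_itv.
  - by apply: nonincreasing_emeasurable => //; exact: measurable_dyadic_itv.
  - by move=> x; rewrite /dyadic_itv/= in_itv/= => /andP[/ltW ? _]; exact: Gni.
rewrite h; apply: lee_wpmul2r => //.
rewrite lee_fin mulrDr mulr1 pow2D.
have := pow2_gt0 (p * k%:~R); have := pow2_gt0 p.
rewrite lerBlDr mulrA [c * _ * _]mulrAC => ? ?; rewrite lerDl; nra.
Qed.

Lemma hausdorff_content_ge0 (R : realType) n (d : R) (E : set 'rV[R]_n) :
  (0 <= hausdorff_content d E)%E.
Proof.
apply: le_ereal_inf_tmp => _ [D [x [r [_ _ ->]]]].
by apply: esum_ge0 => i _; rewrite lee_fin powR_ge0.
Qed.

Lemma le_hausdorff_content (R : realType) n (d : R) (A B : set 'rV[R]_n) :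
  A `<=` B -> (hausdorff_content d A <= hausdorff_content d B)%E.
Proof.
move=> AB; apply: ereal_inf_le_tmp => _ [D [x [r [h1 h2 ->]]]].
by exists D, x, r; split=> //; exact: subset_trans h2.
Qed.

Lemma hausdorff_content_le_esum (R : realType) n (d : R) (E : set 'rV[R]_n)
    (I : countType) (D : set I) (x : I -> 'rV[R]_n) (r : I -> R) :
  (forall i, D i -> 0 < r i) -> E `<=` \bigcup_(i in D) eball (x i) (r i) ->
  (hausdorff_content d E <= \esum_(i in D) (r i `^ d)%:E)%E.
Proof.
move=> r0 ED.
have [[i0 _]|] := pselect (exists i : I, True); last first.
  move=> noI.
  have -> : D = set0 by apply/seteqP; split=> i //= _; case: noI; exists i.
  rewrite esum_set0; apply: ereal_inf_lbound.
  exists set0, (fun=> 0), (fun=> 0); split=> //; last by rewrite esum_set0.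
  by move=> y /ED[i]; case: noI; exists i.
apply: ereal_inf_lbound.
pose g (j : nat) := odflt i0 (pickle_inv j).
have gK i : g (pickle i) = i by rewrite /g pickleK_inv.
exists (pickle @` D), (x \o g), (r \o g); split.
- by move=> _ [i Di <-]; rewrite /= gK; exact: r0.
- move=> y /ED[i Di yi]; exists (pickle i); first by exists i.
  by rewrite /= gK.
- rewrite esum_image; last by move=> k l _ _ /(pcan_inj pickleK).
  by apply: eq_esum => i _ /=; rewrite gK.
Qed.

Lemma esum_le_seq (R : realType) (T : choiceType) (D : set T) (a : T -> \bar R) (M : \bar R) :
  (forall F : seq T, uniq F -> (forall x, x \in F -> D x) -> (\sum_(x <- F) a x <= M)%E) ->
  (\esum_(x in D) a x <= M)%E.
Proof.
move=> h; apply: ge_ereal_sup => _ [X [finX XD] <-].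
rewrite fsbig_finite//=; apply: h; first exact: finmap.fset_uniq.
by move=> x; rewrite in_fset_set// inE => /XD.
Qed.

Lemma seq_le_esum (R : realType) (T : choiceType) (D : set T) (a : T -> \bar R) (F : seq T) :
  uniq F -> (forall x, x \in F -> D x) -> (\sum_(x <- F) a x <= \esum_(x in D) a x)%E.
Proof.
move=> uF FD; apply: ereal_sup_ubound; exists [set` F].
  by split; [exact: finite_seq | move=> x /= /FD].
by rewrite -fsbig_seq.
Qed.

Lemma esumZl_le (R : realType) (T : choiceType) (D : set T) (a : T -> \bar R) (c : R) :
  0 <= c -> (forall x, D x -> (0 <= a x)%E) ->
  (\esum_(x in D) (c%:E * a x) <= c%:E * \esum_(x in D) a x)%E.
Proof.
move=> c0 a0; apply: esum_le_seq => F uF FD.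
rewrite big_seq -ge0_sume_distrr; last by move=> x /FD /a0.
rewrite -big_seq lee_wpmul2l ?lee_fin//.
exact: seq_le_esum.
Qed.

Lemma le_esumZl (R : realType) (T : choiceType) (D : set T) (a : T -> \bar R) (c : R) :
  0 < c -> (forall x, D x -> (0 <= a x)%E) ->
  ((c%:E * (\esum_(x in D) a x)) <= (\esum_(x in D) (c%:E * a x)))%E.
Proof.
move=> c0 a0.
rewrite muleC -lee_pdivlMr// muleC.
have h : (\esum_(x in D) a x = \esum_(x in D) (c^-1%:E * (c%:E * a x)))%E.
  by apply: eq_esum => x _; rewrite muleA -EFinM mulVf ?gt_eqF// mul1e.
rewrite {1}h; apply: esumZl_le; first by rewrite invr_ge0 ltW.
by move=> x Dx; rewrite mule_ge0 ?a0// lee_fin ltW.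
Qed.

Lemma term_le_esum (R : realType) (T : choiceType) (D : set T) (a : T -> \bar R) i :
  D i -> (a i <= \esum_(x in D) a x)%E.
Proof.
move=> Di; have := @seq_le_esum R T D a [:: i] isT.
by rewrite big_seq1; apply=> x; rewrite inE => /eqP ->.
Qed.

(** Each superlevel set is covered with an error that decays geometrically in both
directions relative to the weight [2 ^ (- p k)] of its level, so that the errors
add up to a multiple of [W]. Rounding the radii to powers of two costs a factor
[2 ^ delta]. *)
Lemma efficient_cover (R : realType) (n : nat) (delta p : R) : 0 < delta -> 0 < p ->
  exists2 C : R, 0 < C & forall (Omega : set 'rV[R]_n) (f : 'rV[R]_n -> R) (W : R),
  0 < W -> (forall x, 0 <= f x) ->
  (choquet_integral delta Omega (fun x => (f x `^ p)%:E) < W%:E)%E ->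
  exists (D : set (int * nat)) (y : int * nat -> 'rV[R]_n) (b : int * nat -> int),
    (forall k x, Omega x -> pow2 k%:~R < f x ->
       exists2 j, D (k, j) & eball (y (k, j)) (pow2 (b (k, j))%:~R) x) /\
    (\esum_(i in D) (pow2 (p * i.1%:~R + delta * (b i)%:~R))%:E <= (C * W)%:E)%E.
Proof.
move=> delta0 p0.
have [C0 C00 hC0] := @sum_pow2_two_sided R 1 ltr01.
have r0 : 0 < 1 - pow2 (- p) by rewrite subr_gt0 pow2_lt1 oppr_lt0.
exists (pow2 delta * ((1 - pow2 (- p))^-1 + C0)).
  by rewrite mulr_gt0 ?pow2_gt0// addr_gt0// invr_gt0.
move=> Om f W W0 f0 hW.
pose G (t : R) := hausdorff_content delta [set x | Om x /\ (t%:E < (f x `^ p)%:E)%E].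
have Gni s t : s <= t -> (G t <= G s)%E.
  move=> st; apply: le_hausdorff_content => x [Ox h]; split=> //.
  by apply: le_lt_trans h; rewrite lee_fin.
have G0 t : (0 <= G t)%E by exact: hausdorff_content_ge0.
pose H (k : int) := G (pow2 (p * k%:~R)).
have H0 k : (0 <= H k)%E by exact: G0.
have HW : (\esum_(k in [set: int]) ((pow2 (p * k%:~R))%:E * H k) <=
           ((1 - pow2 (- p))^-1 * W)%:E)%E.
  have h := le_lt_trans (dyadic_sum_le_integral p0 Gni G0) hW.
  rewrite EFinM -lee_pdivrMl ?invr_gt0// invrK.
  apply: le_trans (ltW h); apply: le_trans (le_esumZl r0 _) _.
    by move=> k _; rewrite mule_ge0// lee_fin pow2_ge0.
  apply: le_esum => k _; rewrite muleA -EFinM [(1 - _) * _]mulrC.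
  exact: lexx.
have Hfin k : H k \is a fin_num.
  rewrite ge0_fin_numE//.
  have := le_lt_trans (le_trans (@term_le_esum R _ _ (fun k : int => ((pow2 (p * k%:~R))%:E * H k)%E) k I) HW) (ltry _).
  move: (H k) (H0 k) => h; case: h => [r| |]// _; rewrite ?ltry//.
  by rewrite gt0_muley ?lte_fin ?pow2_gt0.
pose e (k : int) : R := pow2 (- (p * k%:~R)) * pow2 (- (1 * `|k%:~R - 0|)) * W.
have e0 k : 0 < e k by rewrite !mulr_gt0 ?pow2_gt0.
have : forall k : int, exists z : set nat * (nat -> 'rV[R]_n) * (nat -> int),
   [set x | Om x /\ ((pow2 (p * k%:~R))%:E < (f x `^ p)%:E)%E] `<=`
     \bigcup_(i in z.1.1) eball (z.1.2 i) (pow2 (z.2 i)%:~R) /\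
   (\esum_(i in z.1.1) (pow2 (delta * (z.2 i)%:~R))%:E <= (pow2 delta)%:E * (H k + (e k)%:E))%E.
  move=> k; have := lb_ereal_inf_adherent (e0 k) (Hfin k).
  move=> [s [D [x [r [r_gt0 sub ->]]]] hs].
  have : forall i, exists b : int, D i -> r i <= pow2 b%:~R /\ pow2 b%:~R <= 2 * r i.
    move=> i; have [Di|nDi] := pselect (D i); last by exists 0.
    by have [b hb] := pow2_round (r_gt0 i Di); exists b.
  move=> /choice[b hb]; exists (D, x, b); split=> /=.
    move=> z /sub[i Di zi]; exists i => //; move: zi.
    by rewrite /eball/= => /lt_le_trans; apply; have [] := hb _ Di.
  apply: (@le_trans _ _ (\esum_(i in D) ((pow2 delta)%:E * (r i `^ delta)%:E))%E).
    apply: le_esum => i Di; rewrite -EFinM lee_fin.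
    have [_ h] := hb _ Di.
    rewrite mulrC -pow2_powR -[pow2 delta]/(2 `^ delta) mulrC -powRM//; last exact/ltW/r_gt0.
    have ri := ltW (r_gt0 _ Di).
    apply: ge0_ler_powR => //; first exact: ltW.
    - by rewrite nnegrE pow2_ge0.
    - by rewrite nnegrE mulr_ge0.
    - by rewrite mulrC.
  apply: le_trans (esumZl_le _ _) _; first exact: pow2_ge0.
    by move=> i _; rewrite lee_fin powR_ge0.
  by rewrite lee_wpmul2l ?lee_fin ?pow2_ge0//; exact: ltW.
move=> /choice[z hz].
pose D := [set i : int * nat | (z i.1).1.1 i.2].
exists D, (fun i => (z i.1).1.2 i.2), (fun i => (z i.1).2 i.2); split.
  move=> k x Ox fx; have [h _] := hz k.
  have [|i Di xi] := h x; last by exists i.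
  split=> //; rewrite lte_fin mulrC -pow2_powR.
  by rewrite gt0_ltr_powR ?nnegrE ?pow2_ge0.
have -> : D = [set: int] `*`` (fun k => (z k).1.1).
  by apply/seteqP; split=> [[k j]|[k j]] /=; [|case].
rewrite -(@esum_esum R _ _ _ _ (fun k j => (pow2 (p * k%:~R + delta * ((z k).2 j)%:~R))%:E));
  last by move=> *; rewrite lee_fin pow2_ge0.
apply: (@le_trans _ _ (\esum_(k in [set: int]) ((pow2 delta)%:E * ((pow2 (p * k%:~R))%:E * H k + (pow2 (- (1 * `|k%:~R - 0|)) * W)%:E)))%E).
  apply: le_esum => k _.
  apply: (@le_trans _ _ (\esum_(j in (z k).1.1) ((pow2 (p * k%:~R))%:E * (pow2 (delta * ((z k).2 j)%:~R))%:E))%E).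
    by apply: le_esum => j _; rewrite -EFinM pow2D lexx.
  apply: le_trans (esumZl_le _ _) _; first exact: pow2_ge0.
    by move=> i _; rewrite lee_fin pow2_ge0.
  have [_ h] := hz k.
  apply: (le_trans (lee_wpmul2l _ h)); first by rewrite lee_fin pow2_ge0.
  rewrite muleCA muleDr ?fin_num_adde_defl//.
  have -> : ((pow2 (p * k%:~R))%:E * (e k)%:E)%E = (pow2 (- (1 * `|k%:~R - 0|)) * W)%:E.
    by rewrite -EFinM /e !mulrA -pow2D subrr pow20 [1 * pow2 _]mul1r.
  exact: lexx.
apply: le_trans (esumZl_le _ _) _; first exact: pow2_ge0.
  move=> k _; apply: adde_ge0; first by rewrite mule_ge0// lee_fin pow2_ge0.
  by rewrite lee_fin mulr_ge0 ?pow2_ge0// ltW.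
rewrite -mulrA EFinM; apply: lee_wpmul2l; first by rewrite lee_fin pow2_ge0.
rewrite esumD; last 2 first.
- by move=> k _; rewrite mule_ge0// lee_fin pow2_ge0.
- by move=> k _; rewrite lee_fin mulr_ge0 ?pow2_ge0// ltW.
rewrite mulrDl EFinD; apply: leeD => //.
apply: esum_le_seq => F uF _.
rewrite sumEFin lee_fin -mulr_suml ler_pM2r//.
exact: hC0.
Qed.

(** * Stopping cells and the fractional maximal estimate *)

Lemma enorm_le (R : realType) n (x : 'rV[R]_n) (M : R) :
  0 <= M -> (forall i, `|x ord0 i| <= M) -> enorm x <= n%:R * M.
Proof.
move=> M0 xM; rewrite /enorm -[leRHS]ger0_norm ?mulr_ge0//.
rewrite -sqrtr_sqr ler_sqrt ?sqr_ge0//.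
apply: (@le_trans _ _ (\sum_(i < n) M ^+ 2)).
  by apply: ler_sum => i _; rewrite -real_normK ?num_real// lerXn2r ?nnegrE//.
rewrite sumr_const card_ord -[M ^+ 2 *+ n]mulr_natl exprMn.
apply: ler_wpM2r; first exact: sqr_ge0.
by case: n {x xM} => [|n]; rewrite ?expr0n//= -natrX ler_nat leq_pmulr.
Qed.

Lemma le_enorm (R : realType) n (x : 'rV[R]_n) i : `|x ord0 i| <= enorm x.
Proof.
rewrite /enorm -sqrtr_sqr ler_sqrt; last by apply: sumr_ge0 => *; exact: sqr_ge0.
by rewrite (bigD1 i)//= lerDl sumr_ge0// => *; exact: sqr_ge0.
Qed.

(** A cell is encoded by the integer coordinates of its lower corner, in units of
its side [2 ^ a]. *)
Definition cell (R : realType) (n : nat) (a : int) (z : 'rV[R]_n) : {ffun 'I_n -> int} :=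
  [ffun i => Num.floor (z ord0 i / pow2 a%:~R)].

Lemma floor_div_nat (R : realType) (x : R) (N : nat) : (0 < N)%N ->
  Num.floor (x / N%:R) = Num.floor ((Num.floor x)%:~R / N%:R : R).
Proof.
move=> N0; have N0' : (0 : R) < N%:R by rewrite ltr0n.
apply/eqP; rewrite eq_le; apply/andP; split; last first.
  by apply: le_floor; rewrite ler_pM2r ?invr_gt0// floor_le.
rewrite floor_ge_int ler_pdivlMr// -[N%:R]/((N%:Z)%:~R) -intrM ler_int.
by rewrite floor_ge_int intrM -ler_pdivlMr// floor_le.
Qed.

Lemma cell_nested (R : realType) (n : nat) (a a' : int) (z z' : 'rV[R]_n) :
  a <= a' -> cell a z = cell a z' -> cell a' z = cell a' z'.
Proof.
move=> aa' /ffunP h; apply/ffunP => i; have := h i; rewrite !ffunE => hi.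
pose N := `|a' - a|%N; have e : a' = a + N%:Z by rewrite /N; lia.
have -> : pow2 a'%:~R = pow2 a%:~R * (2 ^ N)%N%:R :> R.
  by rewrite e intrD pow2D natrX -powR_mulrn.
rewrite !invfM !mulrA floor_div_nat ?expn_gt0// hi.
by rewrite -floor_div_nat ?expn_gt0.
Qed.

Lemma int_max_exists (P : int -> Prop) (a0 B : int) : P a0 ->
  (forall a, P a -> a <= B) ->
  exists a, [/\ a0 <= a, P a & forall a', a < a' -> ~ P a'].
Proof.
move=> P0 PB.
have ex : exists j : nat, `[< P (a0 + j%:Z) >] by exists 0%N; apply/asboolP; rewrite addr0.
have ub j : `[< P (a0 + j%:Z) >] -> (j <= `|B - a0|)%N.
  by move=> /asboolP /PB; lia.
case: (ex_maxnP ex ub) => j /asboolP Pj hj.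
exists (a0 + j%:Z); split => //; first by lia.
move=> a' haa' Pa'.
have := hj `|a' - a0|%N; rewrite (_ : a0 + _ = a'); last by lia.
by move=> /(_ (introT (asboolP _) Pa')); lia.
Qed.

Lemma seq_int_max (m : int) (F : seq int) :
  exists2 M, M \in m :: F & forall k, k \in m :: F -> k <= M.
Proof.
elim: F m => [|m' F IH] m; first by exists m; [|move=> k]; rewrite inE// => /eqP ->.
have [M MF hM] := IH m'; have [le|/ltW le] := leP m M.
  exists M; first by rewrite inE MF orbT.
  by move=> k; rewrite inE => /predU1P[->//|/hM].
exists m; first by rewrite inE eqxx.
by move=> k; rewrite inE => /predU1P[->//|/hM/le_trans]; exact.
Qed.

Section stopping.
Context (R : realType) (n : nat) (delta kappa p p1 : R).
Context (D : set (int * nat)) (y : int * nat -> 'rV[R]_n) (b : int * nat -> int).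

(** A pair [i] in [D] stands for the ball of level [i.1] with center [y i] and radius
[2 ^ (b i)]. *)
Definition cell_mass (k a : int) (v : {ffun 'I_n -> int}) : \bar R :=
  \esum_(i in [set i | [/\ D i, i.1 = k & cell a (y i) = v]])
    (pow2 (delta * (b i)%:~R))%:E.

(** The volume fraction of the level set [f > 2 ^ k] in the cell is at most the power
[n / delta] of [cell_mass] divided by the [delta]-th power of the side. A heavy
cell may thus have a large mean of [f] at level [k]: the exponent [p1] is chosen
with [p1 n / delta > 1], so that the mean over a cell that is heavy at no level
is at most a multiple of [2 ^ (m - kappa a)]. *)
Definition heavy (m k a : int) (v : {ffun 'I_n -> int}) : Prop :=
  m%:~R - kappa * a%:~R <= k%:~R /\
  ((pow2 (p1 * (m%:~R - kappa * a%:~R - k%:~R) + delta * a%:~R))%:E <= cell_mass k a v)%E.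

Definition near_heavy (m : int) : set 'rV[R]_n :=
  [set x | exists i a, [/\ D i, heavy m i.1 a (cell a (y i)) &
     forall j, `|x ord0 j - y i ord0 j| <= 2 * pow2 a%:~R]].

Definition top_scale (m : int) (i : int * nat) : set int :=
  [set a | heavy m i.1 a (cell a (y i)) /\
           forall a', a < a' -> ~ heavy m i.1 a' (cell a' (y i))].

Definition stopped (m : int) : set (int * nat) :=
  [set i | D i /\ exists a, top_scale m i a].

Definition stop (m : int) (i : int * nat) : int := xget 0 (top_scale m i).

Definition stop_cell (m : int) (i : int * nat) : int * int * {ffun 'I_n -> int} :=
  (i.1, stop m i, cell (stop m i) (y i)).

Hypothesis p10 : 0 < p1.
Hypothesis kappa0 : 0 <= kappa.

Lemma le_heavy (m m' k a : int) v : m <= m' -> heavy m' k a v -> heavy m k a v.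
Proof.
move=> mm' [h1 h2]; have mm : (m%:~R : R) <= m'%:~R by rewrite ler_int.
split; first by lra.
apply: le_trans h2; rewrite lee_fin pow2_le lerD2r ler_pM2l//; lra.
Qed.

Lemma top_scale_uniq m i a a' : top_scale m i a -> top_scale m i a' -> a = a'.
Proof.
move=> [h1 h2] [h3 h4]; apply/eqP; rewrite eq_le !leNgt.
by apply/andP; split; apply/negP => aa; [exact: (h4 _ aa)|exact: (h2 _ aa)].
Qed.

Lemma stopE m i a : top_scale m i a -> stop m i = a.
Proof.
by move=> ha; rewrite /stop; case: xgetP => [z -> hz|/(_ a)//]; exact: top_scale_uniq hz ha.
Qed.

Lemma stop_top m i : stopped m i -> top_scale m i (stop m i).
Proof. by move=> [_ [a ha]]; rewrite (stopE ha). Qed.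

(** Raising the size [2 ^ m] makes fewer cells heavy, so stopping scales decrease.
This is what makes the charges of one ball geometric in [m]. *)
Lemma stop_nonincreasing m m' i : m <= m' -> stopped m i -> stopped m' i ->
  stop m' i <= stop m i.
Proof.
move=> mm' /stop_top[_ h1] /stop_top[h2 _]; rewrite leNgt; apply/negP => /h1.
by apply; exact: le_heavy h2.
Qed.

Context (W : R).
Hypothesis W0 : 0 < W.
Hypothesis mass : (\esum_(i in D) (pow2 (p * i.1%:~R + delta * (b i)%:~R))%:E <= W%:E)%E.
Hypothesis kp1 : kappa * p1 < delta.

Lemma cell_mass_le k a v : (cell_mass k a v <= (pow2 (- (p * k%:~R)) * W)%:E)%E.
Proof.
apply: esum_le_seq => F uF FD; rewrite sumEFin lee_fin.
apply: (@le_trans _ _ (pow2 (- (p * k%:~R)) * \sum_(i <- F) pow2 (p * i.1%:~R + delta * (b i)%:~R))).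
  rewrite mulr_sumr big_seq [leRHS]big_seq; apply: ler_sum => i /FD[_ -> _].
  by rewrite -pow2D addrA addNr add0r.
rewrite ler_pM2l ?pow2_gt0// -lee_fin -sumEFin.
apply: le_trans mass; apply: seq_le_esum => // i /FD[]//.
Qed.

(** A heavy cell of side [2 ^ a] weighs at least a positive power of [2 ^ a], as
[kappa * p1 < delta], while the total weight is finite: heavy cells of one level
are bounded in size. *)
Lemma heavy_stopped m i a : D i -> heavy m i.1 a (cell a (y i)) ->
  stopped m i /\ a <= stop m i.
Proof.
move=> Di ha.
suff [a1 [aa1 h1 h2]] : exists a', [/\ a <= a', heavy m i.1 a' (cell a' (y i)) &
    forall a'', a' < a'' -> ~ heavy m i.1 a'' (cell a'' (y i))].
  have top1 : top_scale m i a1 by [].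
  by split; [split=> //; exists a1 | rewrite (stopE top1)].
have [w hw] := pow2_log W0.
(* The mass of a heavy cell lies between its threshold and the bound of
[cell_mass_le]; comparing exponents gives the largest possible scale. *)
apply: (@int_max_exists _ _
  (Num.floor ((- (p * i.1%:~R) + w - p1 * (m%:~R - i.1%:~R)) / (delta - kappa * p1)) + 1)) => // a' [_ h].
have := le_trans h (cell_mass_le _ _ _).
rewrite hw -pow2D lee_fin pow2_le => h'.
rewrite -(ler_int R); have /andP[_ /ltW h2] := floor_itv ((- (p * i.1%:~R) + w - p1 * (m%:~R - i.1%:~R)) / (delta - kappa * p1)).
apply: le_trans h2; rewrite ler_pdivlMr ?subr_gt0//.
lra.
Qed.

(** Cells are nested, so all the balls centered in a maximal heavy cell stop there. *)
Lemma stop_cell_fiber m i i' : stopped m i -> D i' -> i'.1 = i.1 ->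
  cell (stop m i) (y i') = cell (stop m i) (y i) ->
  stopped m i' /\ stop_cell m i' = stop_cell m i.
Proof.
move=> si Di' e1 e2; have [h1 h2] := stop_top si.
have top' : top_scale m i' (stop m i).
  split; first by rewrite e1 e2.
  move=> a' aa'; rewrite e1 (cell_nested (ltW aa') e2); exact: h2.
split; first by split=> //; exists (stop m i).
by rewrite /stop_cell (stopE top') e1 e2.
Qed.

Definition charge (m : int) (i : int * nat) : R :=
  pow2 ((p - p1) * (m%:~R - kappa * (stop m i)%:~R - i.1%:~R)).

Definition weight (i : int * nat) : R := pow2 (p * i.1%:~R + delta * (b i)%:~R).

(** A heavy cell is paid for by the balls centered in it; in terms of their weights
its cost carries the factor [charge], a positive power of
[2 ^ (m - kappa a) / 2 ^ k], which is at most one. *)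
Lemma stop_cell_cost m Q : (stop_cell m @` stopped m) Q ->
  ((pow2 (p * m%:~R + (delta - kappa * p) * Q.1.2%:~R))%:E <=
   \esum_(i in stopped m `&` stop_cell m @^-1` [set Q]) (weight i * charge m i)%:E)%E.
Proof.
move=> [i si <-] {Q}; have [[h1 h2] _] := stop_top si.
set Q := stop_cell m i; pose k : R := i.1%:~R; pose a : R := (stop m i)%:~R.
pose c : R := p * k + (p - p1) * (m%:~R - kappa * a - k).
apply: (@le_trans _ _ ((pow2 c)%:E * cell_mass i.1 (stop m i) (cell (stop m i) (y i)))%E).
  apply: (@le_trans _ _ ((pow2 c)%:E * (pow2 (p1 * (m%:~R - kappa * a - k) + delta * a))%:E)%E).
    rewrite -EFinM -pow2D lee_fin pow2_le /c /= -/a -/k; lra.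
  by apply: lee_wpmul2l; rewrite ?lee_fin ?pow2_ge0.
apply: le_trans (le_esumZl (pow2_gt0 _) _) _; first by move=> *; rewrite lee_fin pow2_ge0.
have -> : [set i0 | [/\ D i0, i0.1 = i.1 & cell (stop m i) (y i0) = cell (stop m i) (y i)]] =
  stopped m `&` stop_cell m @^-1` [set Q].
  apply/seteqP; split=> i' /=.
    by move=> [Di' e1 e2]; exact: stop_cell_fiber.
  move=> [[Di' _]] e; have e1 : i'.1 = i.1 := congr1 (fun q => q.1.1) e.
  have e2 : stop m i' = stop m i := congr1 (fun q => q.1.2) e.
  have e3 : cell (stop m i') (y i') = cell (stop m i) (y i) := congr1 snd e.
  move: e3; rewrite e2 => e3; exact: And3 Di' e1 e3.
apply: le_esum => i' [si' /= e].
have e1 : i'.1 = i.1 := congr1 (fun q => q.1.1) e.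
have e2 : stop m i' = stop m i := congr1 (fun q => q.1.2) e.
rewrite -EFinM -pow2D lee_fin /weight /charge -pow2D pow2_le.
rewrite e1 e2 /c -/k -/a; lra.
Qed.

(** The stopping cells partition the stopped balls. *)
Lemma esum_stop_cell m (h : int * nat -> \bar R) : (forall i, 0 <= h i)%E ->
  (\esum_(Q in stop_cell m @` stopped m)
     \esum_(i in stopped m `&` stop_cell m @^-1` [set Q]) h i =
   \esum_(i in stopped m) h i)%E.
Proof.
move=> h0; rewrite (@esum_esum _ _ _ _ _ (fun _ i => h i))//.
rewrite [X in esum X _](_ : _ = (fun i => (stop_cell m i, i)) @` stopped m).
  by rewrite esum_image; last by move=> i j _ _ /(congr1 snd).
apply/seteqP; split=> [[Q i] /= [_ [si e]]|_ /= [i si <-]].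
  by exists i => //; rewrite -e.
by split=> //=; exists i.
Qed.

Hypothesis p1p : p1 < p.
Hypothesis n0 : (0 < n)%N.

Lemma content_near_heavy m :
  (hausdorff_content (delta - kappa * p) (near_heavy m) <=
   \esum_(Q in stop_cell m @` stopped m) ((4 * n%:R * pow2 Q.1.2%:~R) `^ (delta - kappa * p))%:E)%E.
Proof.
apply: (@hausdorff_content_le_esum R n (delta - kappa * p) _ _ _
  (fun Q : int * int * {ffun 'I_n -> int} => \row_j ((Q.2 j)%:~R * pow2 Q.1.2%:~R))).
  by move=> Q _; rewrite !mulr_gt0 ?pow2_gt0 ?ltr0n.
move=> x [i [a [Di ha xi]]]; have [si ale] := heavy_stopped Di ha.
exists (stop_cell m i); first by exists i.
rewrite /eball/=; set l := pow2 (stop m i)%:~R.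
have l0 : 0 < l by exact: pow2_gt0.
apply: (@le_lt_trans _ _ (n%:R * (3 * l))).
  apply: enorm_le; first by rewrite mulr_ge0// ltW.
  move=> j; rewrite !mxE ffunE -/l.
  have h1 : `|x ord0 j - y i ord0 j| <= 2 * l.
    by apply: (le_trans (xi j)); rewrite ler_pM2l// /l pow2_le ler_int.
  have /andP[h2 h3] := floor_itv (y i ord0 j / l).
  move: h2 h3; rewrite ler_pdivlMr// ltr_pdivrMr// intrD mulrDl => h2 h3.
  move: h1; rewrite !ler_norml => /andP[h1 h4]; apply/andP; split; lra.
have n1 : (0 : R) < n%:R by rewrite ltr0n.
nra.
Qed.

(** The charges of one ball decay geometrically below the largest [m] for which it
is stopped: [m - kappa * stop m i] grows at least as fast as [m]. *)
Lemma charge_sum C : (forall (t : R) (F : seq int), uniq F ->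
    \sum_(k <- F) pow2 (- ((p - p1) * `|k%:~R - t|)) <= C) -> 0 <= C ->
  forall i, D i ->
  (\esum_(m in [set m | stopped m i]) (charge m i)%:E <= C%:E)%E.
Proof.
move=> hC C0 i Di; apply: esum_le_seq => F uF FD; rewrite sumEFin lee_fin.
case: F uF FD => [|m0 F0] uF FD; first by rewrite big_nil.
set F := m0 :: F0 in uF FD *.
have [M MF leM] := seq_int_max m0 F0.
apply: le_trans (hC M%:~R F uF).
rewrite big_seq [leRHS]big_seq; apply: ler_sum => m mF.
have sm := FD _ mF; have sM := FD _ MF.
rewrite /charge pow2_le.
have mM : (m%:~R : R) <= M%:~R by rewrite ler_int leM.
rewrite ler0_norm ?subr_le0// opprB.
have -> : - ((p - p1) * (M%:~R - m%:~R)) = (p - p1) * (m%:~R - M%:~R) by ring.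
rewrite ler_pM2l ?subr_gt0//.
have [[h _] _] := stop_top sM.
have : ((stop M i)%:~R : R) <= (stop m i)%:~R by rewrite ler_int stop_nonincreasing// leM.
move=> /(ler_wpM2l kappa0); lra.
Qed.

(** The discrete form of the strong type inequality for the fractional maximal
function between Choquet spaces. *)
Lemma sum_content_near_heavy C : (forall (t : R) (F : seq int), uniq F ->
    \sum_(k <- F) pow2 (- ((p - p1) * `|k%:~R - t|)) <= C) -> 0 < C ->
  (\esum_(m in [set: int]) ((pow2 (p * m%:~R))%:E *
       hausdorff_content (delta - kappa * p) (near_heavy m)) <=
   ((4 * n%:R) `^ (delta - kappa * p) * C * W)%:E)%E.
Proof.
move=> hC C0; set s := delta - kappa * p; set c := (4 * n%:R) `^ s.
have w0 i : 0 <= weight i by exact: pow2_ge0.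
have g0 m i : 0 <= charge m i by exact: pow2_ge0.
have wg0 m i : (0 <= (weight i * charge m i)%:E)%E by rewrite lee_fin mulr_ge0.
have c0 : 0 <= c by exact: powR_ge0.
apply: (@le_trans _ _ (\esum_(m in [set: int]) (c%:E * \esum_(i in stopped m) (weight i * charge m i)%:E))%E).
  apply: le_esum => m _.
  apply: (le_trans (lee_wpmul2l _ (content_near_heavy m))); first by rewrite lee_fin pow2_ge0.
  apply: le_trans (le_esumZl (pow2_gt0 _) _) _; first by move=> *; rewrite lee_fin powR_ge0.
  rewrite -esum_stop_cell//.
  apply: (@le_trans _ _ (\esum_(Q in stop_cell m @` stopped m) (c%:E * \esum_(i in stopped m `&` stop_cell m @^-1` [set Q]) (weight i * charge m i)%:E))%E).
    apply: le_esum => Q hQ; apply: le_trans (lee_wpmul2l _ (stop_cell_cost hQ)); last by rewrite lee_fin.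
    rewrite -!EFinM lee_fin pow2D powRM ?mulr_ge0 ?pow2_ge0// pow2_powR -/c.
    by rewrite mulrCA [Q.1.2%:~R * _]mulrC.
  by apply: esumZl_le => // Q _; exact: esum_ge0.
apply: le_trans (esumZl_le c0 _) _; first by move=> m _; exact: esum_ge0.
rewrite -mulrA EFinM; apply: lee_wpmul2l; first by rewrite lee_fin.
rewrite (@esum_esum _ _ _ _ _ (fun m i => (weight i * charge m i)%:E))//.
have -> : [set: int] `*`` stopped = (fun x : (int * nat) * int => (x.2, x.1)) @` (D `*`` (fun i => [set m | stopped m i])).
  apply/seteqP; split=> [[m i] /= [_ si]|_ /= [[i m] /= [_ si] <-]//].
  by exists (i, m) => //=; split=> //; case: si.
rewrite esum_image; last by move=> [i m] [i' m'] _ _ [-> ->].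
rewrite -(@esum_esum _ _ _ _ _ (fun i m => (weight i * charge m i)%:E))//.
apply: (@le_trans _ _ (\esum_(i in D) (C%:E * (weight i)%:E))%E).
  apply: le_esum => i Di; rewrite muleC.
  apply: (@le_trans _ _ ((weight i)%:E * \esum_(m in [set m | stopped m i]) (charge m i)%:E)%E).
    apply: le_trans (esumZl_le (w0 i) _); last by move=> *; rewrite lee_fin.
    by apply: le_esum => m _; rewrite -EFinM.
  by apply: lee_wpmul2l; [rewrite lee_fin|apply: charge_sum => //; exact: ltW].
apply: le_trans (esumZl_le (ltW C0) _) _; first by move=> *; rewrite lee_fin.
by rewrite EFinM; apply: lee_wpmul2l; [rewrite lee_fin ltW|].
Qed.

End stopping.

(** * Curves in John domains *)

Lemma nbhs_cubeP (R : realType) n (z : 'rV[R]_n) (A : set 'rV[R]_n) :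
  nbhs z A <-> exists2 e : R, 0 < e &
    forall w : 'rV[R]_n, (forall i, `|w ord0 i - z ord0 i| < e) -> A w.
Proof.
rewrite -nbhs_ballE; split.
  move=> [e /= e0 he]; exists e => // w hw; apply: he; split=> // i j.
  by rewrite (ord1 i) /ball/= distrC.
move=> [e e0 he]; exists e => //= w [_ hw]; apply: he => i.
by have := hw ord0 i; rewrite /ball/= distrC.
Qed.

Lemma coord_le_norm (R : realType) n (z : 'rV[R]_n) i : `|z ord0 i| <= `|z|.
Proof.
rewrite [leRHS]mx_normrE.
exact: (@le_bigmax _ _ _ 0 (fun ij : 'I_1 * 'I_n => `|z ij.1 ij.2|) (ord0, i)).
Qed.

Lemma norm_le_coord (R : realType) n (z : 'rV[R]_n) (M : R) :
  0 <= M -> (forall i, `|z ord0 i| <= M) -> `|z| <= M.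
Proof.
move=> M0 zM; rewrite [leLHS]mx_normrE; apply: bigmax_le => // -[i j] _ /=.
by rewrite (ord1 i).
Qed.

(** A subdivision of [0, s] followed by [t] subdivides [0, t], so the chord from
[s] to [t] fits into the difference of the two lengths. *)
Lemma arc_length_curve_lipschitz (R : realType) n (l : R) (gamma : R -> 'rV[R]_n) s t :
  arc_length_curve l gamma -> 0 <= s -> s <= t -> t <= l ->
  enorm (gamma t - gamma s) <= t - s.
Proof.
move=> [l0 _ hl] s0 st tl.
have [->|/eqP sNt] := eqVneq s t.
  rewrite !subrr; have := @enorm_le R n 0 0 (lexx _); rewrite mulr0; apply=> i.
  by rewrite mxE normr0.
have {sNt}st : s < t by rewrite lt_neqAle st andbT; apply/eqP.
have hs : curve_length 0 s gamma = s%:E by apply: hl; rewrite in_itv/= s0 (le_trans (ltW st)).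
have ht : curve_length 0 t gamma = t%:E.
  by apply: hl; rewrite in_itv/= tl andbT (le_trans s0)// ltW.
rewrite lerBrDl -lerBrDr -lee_fin -hs.
apply: ge_ereal_sup => _ [ss [pss /eqP lss] <-].
rewrite lee_fin lerBrDr -lee_fin -ht.
apply: ereal_sup_ubound; exists (rcons ss t).
  by split; [rewrite rcons_path pss lss | rewrite last_rcons].
have -> : zip (0 :: rcons ss t) (rcons ss t) = rcons (zip (0 :: ss) ss) (s, t).
  rewrite -lss; elim: ss {pss lss} (0 : R) => //= a ss IH c.
  by rewrite -[zip (a :: _) _]/(zip (a :: rcons ss t) (rcons ss t)) IH.
by rewrite -cats1 big_cat/= big_seq1.
Qed.

Lemma segment_continuous (R : realType) n (z v : 'rV[R]_n) :
  continuous (fun s : R => z + s *: v).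
Proof.
move=> s; apply: cvgD; first exact: cvg_cst.
exact: scalel_continuous.
Qed.

(** On a segment from [z] to a point outside [Om], the first point outside [Om] lies
on the boundary, and it is closer to [z] than [rho]. *)
Lemma cube_in_domain (R : realType) n (Om : set 'rV[R]_n) (z w : 'rV[R]_n) (r rho : R) :
  open Om -> Om z -> (rho%:E <= edist_set z (boundary Om))%E ->
  (forall i, `|w ord0 i - z ord0 i| <= r) -> n%:R * r < rho -> 0 <= r -> Om w.
Proof.
move=> oOm Oz hrho wz nr r0; apply: contrapT => nOw.
pose g (s : R) := z + s *: (w - z).
have cg : continuous g by exact: segment_continuous.
pose A := [set s : R | 0 <= s <= 1 /\ ~ Om (g s)].
have A1 : A 1 by split; [rewrite ler01 lexx | rewrite /g scale1r addrC subrK].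
have lbA : lbound A 0 by move=> s [/andP[]].
have infA : has_inf A by split; [exists 1|exists 0].
have s0 : 0 <= inf A by apply: lb_le_inf => //; exists 1.
have s1 : inf A <= 1 by apply: ge_inf => //; exists 0.
have lt_inf s : 0 <= s -> s < inf A -> Om (g s).
  move=> s00 ss; apply: contrapT => nO; move: (ss); rewrite ltNge => /negP; apply.
  apply: ge_inf; first by exists 0.
  by split=> //; rewrite s00/= ltW// (lt_le_trans ss).
have ninf : ~ Om (g (inf A)).
  move=> Oi; have : nbhs (inf A) (g @^-1` Om) by apply: cg; exact: open_nbhs_nbhs.
  rewrite -nbhs_ballE => -[e /= e0 he].
  have [s [/andP[h1 h2] As] hs] := inf_adherent e0 infA.
  apply: (As); apply: he; rewrite /ball/=.
  have : inf A <= s by apply: ge_inf; [exists 0|split=> //; apply/andP; split].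
  by move=> h3; rewrite distrC ger0_norm ?subr_ge0// ltrBlDl.
have inf0 : 0 < inf A.
  rewrite lt_neqAle s0 andbT; apply/eqP => e; apply: ninf.
  by rewrite -e /g scale0r addr0.
have bd : boundary Om (g (inf A)).
  split; last by move=> /interior_subset.
  move=> B hB; have : nbhs (inf A) (g @^-1` B) by exact: cg.
  rewrite -nbhs_ballE => -[e /= e0 he].
  pose d := Num.min e (inf A) / 2.
  have d0 : 0 < d by rewrite divr_gt0// lt_min e0 inf0.
  have [de dA] : d < e /\ d < inf A.
    have h1 : Num.min e (inf A) <= e by rewrite ge_min lexx.
    have h2 : Num.min e (inf A) <= inf A by rewrite ge_min lexx orbT.
    have h3 : 0 < Num.min e (inf A) by rewrite lt_min e0 inf0.
    by rewrite /d; split; lra.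
  exists (g (inf A - d)); split; first by apply: lt_inf; lra.
  by apply: he; rewrite /ball/= opprB addrC subrK gtr0_norm.
have : (edist_set z (boundary Om) <= (enorm (z - g (inf A)))%:E)%E.
  by apply: ereal_inf_lbound; exists (g (inf A)).
move=> /(le_trans hrho); rewrite lee_fin leNgt => /negP; apply.
apply: le_lt_trans nr; apply: enorm_le => // i.
rewrite /g opprD addrA subrr add0r !mxE normrN normrM ger0_norm//.
by apply: le_trans (wz i); rewrite ler_piMl.
Qed.

(** The curves from all points can be run up to a common length [2 ^ A] by letting
them rest at the center: the distance from the center to the complement exceeds
a multiple of the length of every curve. Distances are measured coordinatewise,
by cubes, which is why the constant loses a factor [n]. *)
Lemma john_cubes (R : realType) n (alpha beta : R) (Om : set 'rV[R]_n) :
  (0 < n)%N -> 0 < alpha -> alpha <= beta -> john_domain alpha beta Om ->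
  exists (x0 : 'rV[R]_n) (A : int), forall x, Om x -> exists gamma : R -> 'rV[R]_n,
    [/\ gamma 0 = x, gamma (pow2 A%:~R) = x0,
        forall (s t : R) i, 0 <= s -> s <= t -> t <= pow2 A%:~R ->
          `|gamma t ord0 i - gamma s ord0 i| <= t - s &
        forall (t : R) (w : 'rV[R]_n), 0 < t -> t <= pow2 A%:~R ->
          (forall i, `|w ord0 i - gamma t ord0 i| <= alpha / (8 * n%:R * beta) * t) -> Om w].
Proof.
move=> n0 al0 alb [[oOm _] [M0 [_ hM]] [x0 Ox0 hjohn]].
have be0 : 0 < beta by exact: lt_le_trans alb.
have nR : (0 : R) < n%:R by rewrite ltr0n.
pose e1 := alpha / (2 * n%:R * beta).
have e10 : 0 < e1 by rewrite divr_gt0// !mulr_gt0.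
have e1E : alpha / (8 * n%:R * beta) = e1 / 4.
  by rewrite /e1; field; rewrite !gt_eqF.
(* The supremum of [S] is the distance from the center to the complement,
measured by cubes. *)
pose S := [set r : R | 0 <= r /\ forall w : 'rV[R]_n, (forall i, `|w ord0 i - x0 ord0 i| <= r) -> Om w].
have ubS : has_ubound S.
  exists (`|M0 + 1| + `|x0 ord0 (Ordinal n0)|) => r [r0 hr].
  have := hr (x0 + const_mx r); have -> : (forall i, `|(x0 + const_mx r) ord0 i - x0 ord0 i| <= r) = True.
    by apply: propT => i; rewrite !mxE addrC addKr ger0_norm.
  move=> /(_ I) /(hM (M0 + 1)); rewrite ltrDl => /(_ ltr01) /= h.
  have := le_trans (coord_le_norm (x0 + const_mx r) (Ordinal n0)) h.
  rewrite !mxE => h2; rewrite -{1}(addrK (x0 ord0 (Ordinal n0)) r) [r + _]addrC.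
  apply: (le_trans (ler_norm _)); apply: le_trans (ler_normB _ _) _.
  by rewrite lerD2r (le_trans h2)// ler_norm.
have [d d0 dS] : exists2 d : R, 0 < d & S d.
  have /nbhs_cubeP[d d0 hd] : nbhs x0 Om by exact: open_nbhs_nbhs.
  exists (d / 2); first exact: divr_gt0.
  split; first by rewrite ltW// divr_gt0.
  move=> w hw; apply: hd => i; apply: (le_lt_trans (hw i)).
  by rewrite ltr_pdivrMr// ltr_pMr// ltr1n.
have hasS : has_sup S by split=> //; exists d.
have supS0 : 0 < sup S by apply: (lt_le_trans d0); exact: ub_le_sup.
(* Rounding to a power of two may double the length, so the cubes are shrunk by
a further factor: on [0, 2 ^ A] they stay smaller than [sup S]. *)
have [A [hA1 hA2]] : exists A : int, sup S / e1 <= pow2 A%:~R /\ pow2 A%:~R <= 2 * (sup S / e1).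
  by apply: pow2_round; exact: divr_gt0.
have cube_S t : 0 <= t -> t <= pow2 A%:~R -> forall w : 'rV[R]_n, (forall i, `|w ord0 i - x0 ord0 i| <= e1 / 4 * t) -> Om w.
  move=> t0 tA w hw.
  have lt : e1 / 4 * t < sup S.
    have : t <= 2 * (sup S / e1) by exact: le_trans hA2.
    rewrite mulrA ler_pdivlMr// => h; nra.
  have lt' : 0 < sup S - e1 / 4 * t by rewrite subr_gt0.
  have [r [r0 hr] ltr] := sup_adherent lt' hasS.
  apply: hr => i; apply: (le_trans (hw i)); lra.
exists x0, A => x Ox.
have [l [gam [arc Ogam [g0 gl] lb hdist]]] := hjohn x Ox.
have l0 : 0 <= l by case: arc.
have cube_gam t (w : 'rV[R]_n) : 0 < t -> t <= l ->
    (forall i, `|w ord0 i - gam t ord0 i| <= e1 * t) -> Om w.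
  move=> t0 tl; have tin : t \in `[0, l] by rewrite in_itv/= (ltW t0).
  move=> hw; apply: (cube_in_domain oOm (Ogam t tin) (hdist t tin) hw).
    have -> : n%:R * (e1 * t) = (alpha / beta * t) / 2.
      by rewrite /e1; field; rewrite !gt_eqF.
    by rewrite ltr_pdivrMr// ltr_pMr ?ltr1n// mulr_gt0// divr_gt0.
  by rewrite mulr_ge0// ltW.
have lA : l <= pow2 A%:~R.
  apply: le_trans hA1; rewrite ler_pdivlMr// mulrC.
  have [->|/eqP l0'] := eqVneq l 0; first by rewrite mulr0 ltW.
  apply: ub_le_sup => //; split; first by rewrite mulr_ge0// ltW.
  move=> w hw; apply: (cube_gam l) => //; first by rewrite lt_neqAle l0 andbT eq_sym; apply/eqP.
  by rewrite gl.
exists (fun t => gam (Num.min t l)); split.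
- by rewrite min_l.
- by rewrite min_r.
- move=> s t i s0 st tA.
  have := le_enorm (gam (Num.min t l) - gam (Num.min s l)) i; rewrite !mxE => /le_trans; apply.
  have h : Num.min s l <= Num.min t l by rewrite le_min2.
  apply: le_trans (arc_length_curve_lipschitz arc _ h _) _.
  + by rewrite le_min s0.
  + by rewrite ge_min lexx orbT.
  + rewrite /Num.min; case: ltP => ?; case: ltP => ?; lra.
- move=> t w t0 tA; rewrite e1E; have [tl|tl] := leP t l.
    move=> hw; apply: (cube_gam t) => // i; apply: (le_trans (hw i)).
    rewrite ler_pM2r//; lra.
  by rewrite gl => hw; apply: (cube_S t) => //; exact: ltW.
Qed.

(** * Lattices, means and level sets *)

Lemma directional_derivative (R : realType) n (u : 'rV[R]_n -> R) (z v : 'rV[R]_n) :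
  differentiable u z ->
  'D_v u z = \sum_(i < n) v ord0 i * gradient u z ord0 i.
Proof.
move=> du; rewrite deriveE// [in LHS](row_sum_delta v) linear_sum.
by apply: eq_bigr => i _; rewrite linearZ/= mxE deriveE.
Qed.

Lemma mean_value_coord (R : realType) n (u : 'rV[R]_n -> R) (P Q : 'rV[R]_n) (mu : R) :
  (forall i, `|Q ord0 i - P ord0 i| <= mu) ->
  (forall s, 0 <= s <= 1 -> differentiable u (P + s *: (Q - P))) ->
  exists2 s, 0 <= s <= 1 &
    `|u Q - u P| <= n%:R * mu * enorm (gradient u (P + s *: (Q - P))).
Proof.
move=> hmu du; pose v := Q - P; pose g (s : R) := u (P + s *: v).
have gE s : (fun h : R => h^-1 *: ((g \o shift s) (h *: (1 : R)) - g s)) =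
   (fun h => h^-1 *: ((u \o shift (P + s *: v)) (h *: v) - u (P + s *: v))).
  apply/funext => h; congr (_ *: (_ - _)); rewrite /g /=; congr u.
  have -> : h *: (1 : R) = h by rewrite -[RHS]mulr1.
  by rewrite scalerDl addrCA.
have dg (s : R) : 0 <= s <= 1 -> is_derive s (1 : R) g ('D_v u (P + s *: v)).
  move=> hs; apply: DeriveDef; last by rewrite /derive gE.
  by rewrite /derivable gE; apply: diff_derivable; exact: du.
have cg : {within `[0, 1], continuous g}.
  apply: derivable_within_continuous => s; rewrite in_itv/= => hs.
  by have := dg s hs => -[].
have dg' (s : R) : s \in `]0, 1[ -> is_derive s (1 : R) g ('D_v u (P + s *: v)).
  by rewrite in_itv/= => /andP[s0 s1]; apply: dg; rewrite !ltW.
have [s] := MVT ltr01 dg' cg.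
rewrite in_itv/= => /andP[/ltW s0 /ltW s1].
rewrite /g scale0r scale1r addr0 /v [P + _]addrC subrK subr0 mulr1 => ->.
exists s; first by rewrite s0.
rewrite directional_derivative; last by apply: du; rewrite s0.
apply: le_trans (ler_norm_sum _ _ _) _.
apply: (@le_trans _ _ (\sum_(i < n) mu * enorm (gradient u (P + s *: (Q - P))))).
  apply: ler_sum => i _; rewrite normrM ler_pM//; last exact: le_enorm.
  by have := hmu i; rewrite !mxE.
by rewrite sumr_const card_ord -[X in X <= _]mulr_natl mulrA.
Qed.

Lemma card_lattice_interval (R : realType) (M : nat) (g h c rho : R) :
  0 < h -> 0 <= rho ->
  #|[pred w : 'I_M | `|g + h * w%:R - c| <= rho]|%:R <= 2 * rho / h + 1 :> R.
Proof.
move=> h0 rho0; set B := [pred w : 'I_M | _].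
have q0 : 0 <= 2 * rho / h by rewrite divr_ge0 ?mulr_ge0// ltW.
have [->|] := eqVneq #|B| 0%N; first by rewrite addr_ge0.
rewrite -lt0n => /card_gt0P[w0 Bw0].
pose w1 := [arg min_(w < w0 | B w) w : nat]%N.
have [Bw1 hmin] : B w1 /\ forall w, B w -> (w1 <= w)%N.
  by rewrite /w1; case: arg_minnP.
pose K := Num.trunc (2 * rho / h).
apply: (@le_trans _ _ (K.+1)%:R); last first.
  by rewrite -natr1 lerD2r; have /andP[] := truncn_itv q0.
rewrite ler_nat.
have -> : #|B| = size [seq val w | w <- enum B] by rewrite size_map cardE.
rewrite -(size_iota w1 K.+1); apply: uniq_leq_size.
  by rewrite map_inj_uniq ?enum_uniq//; exact: val_inj.
move=> _ /mapP[w + ->]; rewrite mem_enum => Bw.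
rewrite mem_iota hmin//= addnS ltnS -leq_subLR.
rewrite /K truncn_ge_nat// ler_pdivlMr// natrB ?hmin//.
move: Bw Bw1; rewrite !inE !ler_norml => /andP[h1 h2] /andP[h3 h4].
by rewrite mulrC; lra.
Qed.

Lemma card_lattice_cube (R : realType) (n M : nat) (g c : 'I_n -> R) (h rho : R) :
  0 < h -> 0 <= rho ->
  #|[pred w : {ffun 'I_n -> 'I_M} | [forall i, `|g i + h * (w i)%:R - c i| <= rho]]|%:R
    <= (2 * rho / h + 1) ^+ n :> R.
Proof.
move=> h0 rho0.
have -> : #|[pred w : {ffun 'I_n -> 'I_M} | [forall i, `|g i + h * (w i)%:R - c i| <= rho]]| =
   (\prod_(i < n) #|[pred w : 'I_M | (`|g i + h * w%:R - c i| <= rho)%R]|)%N.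
  transitivity #|family (fun i => [pred w : 'I_M | `|g i + h * w%:R - c i| <= rho])|.
    by apply: eq_card => w; rewrite !inE; apply: eq_forallb => i.
  by rewrite card_family foldrE big_map big_enum.
rewrite natr_prod -[n in _ ^+ n](card_ord n) -prodr_const.
by apply: ler_prod => i _; rewrite ler0n/= card_lattice_interval.
Qed.

Lemma sum_pow2_range (R : realType) (k0 : R) (N : nat) :
  pow2 k0 + \sum_(0 <= j < N) pow2 (k0 + j%:R) = pow2 (k0 + N%:R).
Proof.
elim: N => [|N IH]; first by rewrite big_geq// !addr0.
by rewrite big_nat_recr//= addrA IH -natr1 addrA [RHS]pow2D pow21 mulr_natr mulr2n.
Qed.

Lemma le_dyadic_layers (R : realType) (k0 : R) (N : nat) (v : R) :
  v <= pow2 (k0 + N%:R) ->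
  v <= pow2 k0 + \sum_(0 <= j < N) pow2 (k0 + j%:R) * (pow2 (k0 + j%:R) < v)%R%:R.
Proof.
elim: N v => [|N IH] v; first by rewrite big_geq// !addr0.
move=> hv; have [h|h] := leP v (pow2 (k0 + N%:R)).
  rewrite big_nat_recr//= addrA; apply: (le_trans (IH _ h)).
  by rewrite lerDl mulr_ge0// pow2_ge0.
apply: (le_trans hv); rewrite -sum_pow2_range lerD2l.
apply: ler_sum_nat => j /andP[_ jN]; rewrite (_ : (_ < v) = true) ?mulr1//.
by apply: le_lt_trans h; rewrite pow2_le lerD2l ler_nat.
Qed.

(** A layer-cake sum: as [q > 1], it decays geometrically on both sides of the
level [theta]. *)
Lemma sum_density_le (R : realType) (q : R) : 1 < q ->
  exists2 C : R, 0 < C & forall (B theta k0 : R) (N : nat) (phi : nat -> R), 1 <= B ->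
  (forall j, (j < N)%N -> phi j <= 1 /\ phi j <= B * pow2 (q * (theta - (k0 + j%:R)))) ->
  \sum_(0 <= j < N) pow2 (k0 + j%:R) * phi j <= B * C * pow2 theta.
Proof.
move=> q1; pose e := Num.min 1 (q - 1).
have e0 : 0 < e by rewrite lt_min ltr01 subr_gt0.
have e1 : e <= 1 by rewrite ge_min lexx.
have eq1 : e <= q - 1 by rewrite ge_min lexx orbT.
have [C C0 hC] := sum_pow2_two_sided_range e0.
exists C => // B th k0 N phi B1 hphi.
have B0 : 0 < B by exact: lt_le_trans B1.
apply: (@le_trans _ _ (B * pow2 th * \sum_(0 <= j < N) pow2 (- (e * `|k0 + j%:R - th|)))); last first.
  rewrite -[leRHS]mulrA [C * _]mulrC mulrA ler_pM2l ?hC// mulr_gt0// pow2_gt0//.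
rewrite mulr_sumr; apply: ler_sum_nat => j /andP[_ jN].
have [h1 h2] := hphi j jN; rewrite -mulrA -pow2D.
have [le|lt] := leP th (k0 + j%:R).
  rewrite ger0_norm ?subr_ge0//.
  apply: (@le_trans _ _ (pow2 (k0 + j%:R) * (B * pow2 (q * (th - (k0 + j%:R)))))).
    by rewrite ler_pM2l ?pow2_gt0.
  rewrite mulrCA ler_pM2l// -pow2D pow2_le; nra.
rewrite ltr0_norm ?subr_lt0//.
apply: (@le_trans _ _ (pow2 (k0 + j%:R) * 1)); first by rewrite ler_pM2l ?pow2_gt0.
rewrite mulr1; apply: (@le_trans _ _ (pow2 (th + - (e * (- (k0 + j%:R - th)))))).
  by rewrite pow2_le; nra.
by rewrite ler_peMl// pow2_ge0.
Qed.

Lemma sum_powR_le (R : realType) (I : Type) (F : seq I) (w : I -> R) (q : R) :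
  1 <= q -> (forall i, 0 <= w i) ->
  \sum_(i <- F) w i `^ q <= (\sum_(i <- F) w i) `^ q.
Proof.
move=> q1 w0; elim: F => [|i F IH]; first by rewrite !big_nil powR_ge0.
rewrite !big_cons; set S := \sum_(j <- F) w j in IH *.
have S0 : 0 <= S by exact: sumr_ge0.
have q0 : 0 < q by exact: lt_le_trans q1.
apply: (le_trans (lerD (lexx _) IH)).
have mono x z : 0 <= x -> x <= z -> x `^ q <= x * z `^ (q - 1).
  move=> x0 xz; rewrite -(mulr_powRB1 x0 q0); apply: ler_wpM2l => //.
  by apply: ge0_ler_powR => //; rewrite ?subr_ge0// nnegrE// (le_trans x0).
rewrite -(mulr_powRB1 (addr_ge0 (w0 i) S0) q0) mulrDl.
by apply: lerD; apply: mono => //; rewrite ?lerDl ?lerDr.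
Qed.

(** * Balls near a good point *)

Lemma floor_dist_le2 (R : realType) (s t : R) : `|s - t| <= 2 ->
  (Num.floor t - 2 <= Num.floor s <= Num.floor t + 2)%R.
Proof.
rewrite ler_norml => /andP[h1 h2]; have /andP[a1 a2] := floor_itv s.
have /andP[b1 b2] := floor_itv t.
by apply/andP; split; rewrite -ltzD1 -(ltr_int R); move: a1 a2 b1 b2;
  rewrite !intrD ?mulrNz => *; lra.
Qed.

Section near_mass.
Context (R : realType) (n : nat) (delta kappa p1 : R).
Context (D : set (int * nat)) (y : int * nat -> 'rV[R]_n) (b : int * nat -> int).
Hypothesis p10 : 0 < p1.
Hypothesis kappa0 : 0 <= kappa.
Context (x : 'rV[R]_n) (m : int).
Hypothesis far : ~ near_heavy delta kappa p1 D y b m x.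

Lemma far_not_heavy i a : D i -> (forall j, `|x ord0 j - y i ord0 j| <= 2 * pow2 a%:~R) ->
  ~ heavy delta kappa p1 D y b m i.1 a (cell a (y i)).
Proof. by move=> Di hi hh; apply: far; exists i, a. Qed.

(** A large ball of a high level cannot come close to a point far from the heavy
cells: the cell of its own size around its center would be heavy. *)
Lemma far_radius_le (a : int) i : D i ->
  (forall j, `|x ord0 j - y i ord0 j| <= 3 * pow2 a%:~R + pow2 (b i)%:~R) ->
  m%:~R - kappa * (a + 2)%:~R <= i.1%:~R -> b i <= a + 2.
Proof.
move=> Di hi hk; rewrite leNgt; apply/negP => hb.
have ba : ((a + 2)%:~R + 1 : R) <= (b i)%:~R.
  by rewrite -[1]/(1%:~R) -intrD ler_int; lia.
have kb : kappa * ((a + 2)%:~R : R) <= kappa * (b i)%:~R by apply: ler_wpM2l => //; lra.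
apply: (far_not_heavy Di (a := b i)).
  move=> j; apply: (le_trans (hi j)).
  have : 3 * pow2 a%:~R <= pow2 (b i)%:~R :> R.
    apply: (@le_trans _ _ (pow2 (2 + a%:~R))).
      rewrite pow2D ler_pM2r ?pow2_gt0// pow22; lra.
    by rewrite pow2_le; move: ba; rewrite intrD; lra.
  lra.
split; first by lra.
apply: (@le_trans _ _ (pow2 (delta * (b i)%:~R))%:E).
  rewrite lee_fin pow2_le.
  have : p1 * (m%:~R - kappa * (b i)%:~R - i.1%:~R) <= 0.
    by apply: mulr_ge0_le0; [exact: ltW | lra].
  lra.
exact: (@term_le_esum R _ _ (fun i => (pow2 (delta * (b i)%:~R))%:E)).
Qed.

(** Balls that come close to [x] have their centers in the [5 ^ n] cells around that
of [x], none of which is heavy. Two sides of length [2 ^ (a + 2)] exceed the sum of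
[3 * 2 ^ a] and of any radius that [far_radius_le] allows. *)
Lemma near_mass_le (k a : int) (F : seq (int * nat)) : uniq F ->
  (forall i, i \in F -> [/\ D i, i.1 = k &
     forall j, `|x ord0 j - y i ord0 j| <= 3 * pow2 a%:~R + pow2 (b i)%:~R]) ->
  m%:~R - kappa * (a + 2)%:~R <= k%:~R ->
  \sum_(i <- F) pow2 (delta * (b i)%:~R) <=
  5 ^+ n * pow2 (p1 * (m%:~R - kappa * (a + 2)%:~R - k%:~R) + delta * (a + 2)%:~R).
Proof.
move=> uF hF hk; set B := pow2 (_ + _).
pose v (w : {ffun 'I_n -> 'I_5}) : {ffun 'I_n -> int} :=
  [ffun j => cell (a + 2) x j + (w j)%:Z - 2].
have vE w j : v w j = cell (a + 2) x j + (w j)%:Z - 2 by rewrite /v ffunE.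
have near i : i \in F -> forall j, `|x ord0 j - y i ord0 j| <= 2 * pow2 (a + 2)%:~R.
  move=> iF j; have [Di ik hi] := hF _ iF; apply: (le_trans (hi j)).
  have : pow2 (b i)%:~R <= pow2 (a + 2)%:~R :> R.
    by rewrite pow2_le ler_int; apply: (far_radius_le Di hi); rewrite ik.
  have : pow2 (a + 2)%:~R = 4 * pow2 a%:~R :> R.
    by rewrite intrD addrC pow2D pow22.
  have := pow2_gt0 (a%:~R : R); lra.
have ex i : i \in F -> exists w, cell (a + 2) (y i) = v w.
  move=> iF.
  have hj j : (cell (a + 2) x j - 2 <= cell (a + 2) (y i) j <= cell (a + 2) x j + 2)%R.
    rewrite !ffunE; apply: floor_dist_le2.
    rewrite -mulrBl normrM [`|_^-1|]gtr0_norm ?invr_gt0 ?pow2_gt0//.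
    by rewrite ler_pdivrMr ?pow2_gt0// distrC near.
  pose w : {ffun 'I_n -> 'I_5} :=
    [ffun j => inord (absz (cell (a + 2) (y i) j - cell (a + 2) x j + 2))].
  exists w; apply/ffunP => j; rewrite vE.
  have -> : w j = absz (cell (a + 2) (y i) j - cell (a + 2) x j + 2) :> nat.
    by rewrite /w ffunE inordK//; have := hj j; lia.
  by move: (hj j); set A1 := cell _ x j; set A2 := cell _ (y i) j; move: A1 A2 => A1 A2; lia.
apply: (@le_trans _ _ (\sum_(w : {ffun 'I_n -> 'I_5})
    \sum_(i <- F | cell (a + 2) (y i) == v w) pow2 (delta * (b i)%:~R))).
  rewrite (exchange_big_dep xpredT)//= big_seq [leRHS]big_seq; apply: ler_sum => i iF.
  have [w /eqP hw] := ex i iF.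
  by rewrite (bigD1 w)//= lerDl sumr_ge0// => *; exact: pow2_ge0.
apply: (@le_trans _ _ (\sum_(w : {ffun 'I_n -> 'I_5}) B)); last first.
  by rewrite sumr_const card_ffun !card_ord -[leLHS]mulr_natl natrX.
apply: ler_sum => w _; rewrite -big_filter.
set G := [seq i <- F | _].
have GF i : i \in G -> i \in F /\ cell (a + 2) (y i) = v w.
  by rewrite mem_filter => /andP[/eqP -> ->].
case EG : G => [|i0 G0]; first by rewrite big_nil pow2_ge0.
have i0G : i0 \in G by rewrite EG inE eqxx.
rewrite -EG; have [i0F hv] := GF _ i0G; have [Di0 ik _] := hF _ i0F.
have := far_not_heavy Di0 (near _ i0F); rewrite /heavy ik => nh.
rewrite -lee_fin -sumEFin; apply: le_trans (_ : (cell_mass delta D y b k (a + 2) (v w) <= _)%E).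
  apply: seq_le_esum; first exact: filter_uniq.
  by move=> i /GF[iF hi]; have [Di ik' _] := hF _ iF.
by rewrite leNgt; apply/negP => /ltW h; apply: nh; split=> //; rewrite hv.
Qed.

End near_mass.

Lemma level_mass_le (R : realType) (delta p w : R) (D : set (int * nat))
    (b : int * nat -> int) (k : int) (F : seq (int * nat)) :
  (\esum_(i in D) (pow2 (p * i.1%:~R + delta * (b i)%:~R))%:E <= (pow2 w)%:E)%E ->
  uniq F -> (forall i, i \in F -> D i /\ i.1 = k) ->
  \sum_(i <- F) pow2 (delta * (b i)%:~R) <= pow2 (w - p * k%:~R).
Proof.
move=> mass uF hF.
apply: (@le_trans _ _ (pow2 (- (p * k%:~R)) * \sum_(i <- F) pow2 (p * i.1%:~R + delta * (b i)%:~R))).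
  rewrite mulr_sumr big_seq [leRHS]big_seq; apply: ler_sum => i /hF[_ ->].
  by rewrite -pow2D addrA addNr add0r.
rewrite addrC pow2D ler_pM2l ?pow2_gt0// -lee_fin -sumEFin.
by apply: le_trans mass; apply: seq_le_esum => // i /hF[].
Qed.

Lemma enorm_continuous (R : realType) n : continuous (@enorm R n).
Proof.
move=> z; rewrite /enorm.
apply: (@continuous_comp _ _ _ (fun x : 'rV[R]_n => \sum_(i < n) x ord0 i ^+ 2) Num.sqrt);
  last exact: sqrt_continuous.
have c i : (fun x : 'rV[R]_n => x ord0 i) w @[w --> z] --> z ord0 i.
  move=> A; rewrite -nbhs_ballE => -[e /= e0 he].
  apply/nbhs_cubeP; exists e => // w hw; apply: he.
  by rewrite /ball/= distrC.
elim: (index_enum _) => [|i r IH].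
  rewrite (_ : (fun x => _) = cst 0); last by apply/funext => w; rewrite big_nil.
  exact: cst_continuous.
rewrite (_ : (fun x => _) = (fun x : 'rV[R]_n => x ord0 i ^+ 2 + \sum_(j <- r) x ord0 j ^+ 2));
  last by apply/funext => w; rewrite big_cons.
apply: continuousD; last exact: IH.
by apply: (@continuousM _ _ (fun x : 'rV[R]_n => x ord0 i) (fun x => x ord0 i)); exact: c.
Qed.

Lemma eball_open (R : realType) n (z : 'rV[R]_n) (r : R) : open (eball z r).
Proof.
have -> : eball z r = (fun w => enorm (w - z)) @^-1` [set t | t < r] by [].
have c : continuous (fun w : 'rV[R]_n => enorm (w - z)).
  move=> w; apply: continuous_comp; last exact: enorm_continuous.
  apply: (@continuousB _ _ _ (fun w : 'rV[R]_n => w) (fun=> z)); last exact: cst_continuous.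
  by move=> A hA.
by apply: open_comp; [move=> w _; exact: c|exact: open_lt].
Qed.

Lemma continuous_enorm_gradient (R : realType) n (Om : set 'rV[R]_n) u z :
  open Om -> C1_on Om u -> Om z -> {for z, continuous (fun w => enorm (gradient u w))}.
Proof.
move=> oOm [_ cu] Oz.
apply: (@continuous_comp _ _ _ (gradient u) (@enorm R n)); last exact: enorm_continuous.
move: cu; rewrite continuous_open_subspace; last exact: oOm.
move=> cu.
by apply: cu; rewrite inE.
Qed.

Definition inner_cube (R : realType) n (Om : set 'rV[R]_n) (x : 'rV[R]_n) (r d : R) :=
  [set z : 'rV[R]_n | (forall i, `|z ord0 i - x ord0 i| <= r) /\
           (forall w : 'rV[R]_n, ~ Om w -> d <= `|z - w|)].

Lemma inner_cube_sub (R : realType) n (Om : set 'rV[R]_n) (x : 'rV[R]_n) (r d : R) :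
  0 < d -> inner_cube Om x r d `<=` Om.
Proof.
move=> d0 z [_ h]; apply: contrapT => /h; rewrite subrr normr0.
by move/le_lt_trans => /(_ _ d0); rewrite ltxx.
Qed.

Lemma inner_cube_compact (R : realType) n (Om : set 'rV[R]_n) (x : 'rV[R]_n) (r d : R) :
  0 <= r -> compact (inner_cube Om x r d).
Proof.
move=> r0; apply: bounded_closed_compact.
  exists (`|x| + r); split; first exact: num_real.
  move=> M hM z [hz _] /=; apply: le_trans (ltW hM).
  rewrite -[z in `|z|](subrK x) addrC; apply: (le_trans (ler_normD _ _)).
  by rewrite lerD2l; apply: norm_le_coord => // i; rewrite !mxE.
move=> z cz; split.
  move=> i; rewrite leNgt; apply/negP => h.
  have [|w [[hw _] hwz]] := cz [set w : 'rV[R]_n | `|w ord0 i - z ord0 i| < `|z ord0 i - x ord0 i| - r].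
    by apply/nbhs_cubeP; exists (`|z ord0 i - x ord0 i| - r); [rewrite subr_gt0|move=> w; apply].
  have := hw i; have := ler_distD (w ord0 i) (z ord0 i) (x ord0 i).
  rewrite /= distrC in hwz; lra.
move=> w Ow; rewrite leNgt; apply/negP => h.
have e0 : 0 < (d - `|z - w|) / 2 by rewrite divr_gt0 ?subr_gt0.
have [|w' [[_ hw'] hwz]] := cz [set w' : 'rV[R]_n | forall i, `|w' ord0 i - z ord0 i| < (d - `|z - w|) / 2].
  by apply/nbhs_cubeP; exists ((d - `|z - w|) / 2).
have := hw' _ Ow; have := ler_distD z w' w.
have : `|w' - z| <= (d - `|z - w|) / 2.
  by apply: norm_le_coord; [exact: ltW|move=> i; rewrite !mxE; exact/ltW/hwz].
lra.
Qed.

(** The open sets [f < 2 ^ k] and the balls of level [k - 1] cover the compact set;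
passing to the previous level leaves room for the closed condition [2 ^ k <= f]. *)
Lemma finite_level_cover (R : realType) n (Om K : set 'rV[R]_n) (f : 'rV[R]_n -> R)
    (D : set (int * nat)) (y : int * nat -> 'rV[R]_n) (b : int * nat -> int) :
  open Om -> (forall z, Om z -> {for z, continuous f}) -> compact K -> K `<=` Om ->
  (forall k x, Om x -> pow2 k%:~R < f x ->
       exists2 j, D (k, j) & eball (y (k, j)) (pow2 (b (k, j))%:~R) x) ->
  forall k : int, exists F : seq (int * nat),
    [/\ uniq F, forall i, i \in F -> D i /\ i.1 = k - 1 &
        forall z, K z -> pow2 k%:~R <= f z ->
          exists2 i, i \in F & eball (y i) (pow2 (b i)%:~R) z].
Proof.
move=> oOm cf cK KO cov k.
pose D' := [set i : int * nat | D i /\ i.1 = k - 1].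
have cov' z : K z -> pow2 k%:~R <= f z -> exists2 i, D' i & eball (y i) (pow2 (b i)%:~R) z.
  move=> Kz hz; have [|j Dj hj] := cov (k - 1) z (KO _ Kz).
    by apply: lt_le_trans hz; rewrite pow2_lt ltr_int; lia.
  by exists (k - 1, j).
have [[i0 Di0]|nD] := pselect (exists i, D' i); last first.
  by exists [::]; split=> // z Kz hz; have [i Di _] := cov' z Kz hz; case: nD; exists i.
pose low := [set z | Om z /\ f z < pow2 k%:~R].
have olow : open low.
  rewrite openE => z [Oz hz]; near=> w; split; near: w.
    exact: open_nbhs_nbhs.
  by apply: (cf z Oz [set t | t < pow2 k%:~R]); apply: open_nbhs_nbhs; split; first exact: open_lt.
have := cK; rewrite compact_cover => /(_ _ D' (fun i => low `|` eball (y i) (pow2 (b i)%:~R))).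
case.
- by move=> i _; apply: openU => //; exact: eball_open.
- move=> z Kz; have [lt|le] := ltP (f z) (pow2 k%:~R).
    by exists i0 => //; left; split=> //; exact: KO.
  by have [i Di hi] := cov' z Kz le; exists i => //; right.
move=> F FD FK; exists (finmap.enum_fset F); split.
- exact: finmap.fset_uniq.
- by move=> i /FD; rewrite inE.
- move=> z Kz hz; have [i iF [[_]|hi]] := FK z Kz; last by exists i.
  by rewrite ltNge hz.
Unshelve. all: by end_near.
Qed.

(** * Density of a lattice in the level sets *)

Section lattice.
Context (R : realType) (n : nat) (delta kappa p p1 eps : R).
Hypothesis n0 : (0 < n)%N.
Hypothesis delta0 : 0 < delta.
Hypothesis deltan : delta <= n%:R.
Hypothesis kappa0 : 0 <= kappa.
Hypothesis p1gt : delta / n%:R < p1.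
Hypothesis p1p : p1 < p.
Hypothesis eps0 : 0 < eps.
Hypothesis eps1 : eps <= 1.

(** The factors bound the lattice points in one ball, the cells near [x], and the
change from cells of side [2 ^ (a + 2)] to cubes of side [2 ^ a]. *)
Definition density_const : R :=
  (16 / eps + 1) ^+ n * (5 ^+ n) `^ (n%:R / delta) * pow2 (2 * n%:R).

Definition rate : R := p1 * n%:R / delta.

Lemma nR_gt0 : 0 < n%:R :> R. Proof. by rewrite ltr0n. Qed.

Lemma p1_gt0 : 0 < p1.
Proof. by apply: lt_trans p1gt; rewrite divr_gt0// nR_gt0. Qed.

Lemma rate_gt1 : 1 < rate.
Proof. by rewrite /rate ltr_pdivlMr// mul1r -ltr_pdivrMr ?nR_gt0. Qed.

Lemma density_const_ge1 : 1 <= density_const.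
Proof.
have h : (1 : R) <= 5 ^+ n by rewrite exprn_ege1// ler1n.
rewrite /density_const; apply: mulr_ege1; last by rewrite pow2_ge1 mulr_ge0.
apply: mulr_ege1; first by rewrite exprn_ege1// lerDr divr_ge0// ltW.
rewrite -[leLHS](powRr0 (5 ^+ n)) ler_powR// divr_ge0//; exact: ltW.
Qed.

Context (D : set (int * nat)) (y : int * nat -> 'rV[R]_n) (b : int * nat -> int).
Context (w : R).
Hypothesis mass : (\esum_(i in D) (pow2 (p * i.1%:~R + delta * (b i)%:~R))%:E <= (pow2 w)%:E)%E.

(** The logarithm of the bound for the mean of the gradient at scale [2 ^ a] near a
point far from the heavy cells. The first term comes from the absence of heavy
cells, the second from the total weight. *)
Definition log_mean (m a : int) : R :=
  Num.min (m%:~R - kappa * (a + 2)%:~R) ((w - delta * a%:~R) / p).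

(** The number of lattice points, slightly perturbed, in a ball is at most a multiple
of the [n]-th power of its radius in units of the mesh. Summing over the balls,
as [n >= delta], it is at most the power [n / delta] of the sum of their weights,
which is small because no cell near [x] is heavy, or because the total weight is
bounded. *)
Lemma lattice_density (x z0 : 'rV[R]_n) (m a k : int) (t : R) (M : nat)
    (xi : {ffun 'I_n -> 'I_M} -> 'rV[R]_n) (F : seq (int * nat)) :
  ~ near_heavy delta kappa p1 D y b m x ->
  pow2 a%:~R / 2 <= t <= pow2 a%:~R -> (0 < M)%N ->
  (forall i, `|z0 ord0 i - x ord0 i| <= t) ->
  (forall om i, `|xi om ord0 i - (z0 ord0 i + eps / 2 * t * ((om i)%:R / M%:R))| <= pow2 a%:~R / M%:R) ->
  uniq F -> (forall i, i \in F -> [/\ D i, i.1 = k & (pow2 a%:~R : R) <= M%:R * pow2 (b i)%:~R]) ->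
  #|[pred om | has (fun i => enorm (xi om - y i) < pow2 (b i)%:~R) F]|%:R <=
    M%:R ^+ n * (density_const * pow2 (rate * (log_mean m a - k%:~R))).
Proof.
move=> far /andP[tT1 tT2] M0 hx hxi uF hF.
have MR : 0 < M%:R :> R by rewrite ltr0n.
have T0 := pow2_gt0 (a%:~R : R); set T := pow2 a%:~R in T0 hxi hF tT1 tT2 *.
have t0 : 0 < t by apply: lt_le_trans tT1; rewrite divr_gt0.
have nR := nR_gt0; have p10 := p1_gt0.
have p0 : 0 < p by exact: lt_trans p1p.
pose meets i := [pred om | enorm (xi om - y i) < pow2 (b i)%:~R].
(* A ball that meets the lattice comes close to [x]; the others do not count. *)
pose F' := [seq i <- F | [exists om, meets i om]].
have uF' : uniq F' by exact: filter_uniq.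
have hF' i : i \in F' -> [/\ D i, i.1 = k &
    forall j, `|x ord0 j - y i ord0 j| <= 3 * T + pow2 (b i)%:~R].
  rewrite mem_filter => /andP[/existsP[om /= hom] iF].
  have [Di ik _] := hF _ iF; split=> // j.
  have h1 := hx j; have h2 := hxi om j.
  have h3 := le_lt_trans (le_enorm (xi om - y i) j) hom; rewrite !mxE in h3.
  have h4 : 0 <= eps / 2 * t * ((om j)%:R / M%:R) <= T / 2.
    have q : 0 <= ((om j)%:R / M%:R : R) <= 1.
      by rewrite divr_ge0//= ler_pdivrMr// mul1r ler_nat ltnW.
    have et : eps * t <= t by rewrite ler_piMl// ltW.
    have e2 : eps / 2 * t <= T / 2 by lra.
    have e3 : 0 <= eps / 2 * t by rewrite mulr_ge0 ?ltW// divr_gt0.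
    move: q => /andP[q1 q2]; apply/andP; split; first exact: mulr_ge0.
    apply: le_trans e2; rewrite -[leRHS]mulr1; exact: ler_wpM2l.
  have h5 : T / M%:R <= T by rewrite ler_pdivrMr// ler_peMr ?ler1n// ltW.
  move: h1 h2 h3 h4; rewrite !ler_norml ltr_norml.
  set e := eps / 2 * t * _ => /andP[h11 h12] /andP[h21 h22] /andP[h31 h32] /andP[h41 h42].
  by apply/andP; split; lra.
pose S := \sum_(i <- F') pow2 (delta * (b i)%:~R).
have C20 : 0 <= 16 / eps + 1 by rewrite addr_ge0// divr_ge0// ltW.
(* In each coordinate the ball is an interval of length at most four radii, once
the perturbation is included, and the mesh is at least [eps T / (4 M)]. *)
have card_meets i : i \in F' -> #|meets i|%:R <=
    ((16 / eps + 1) * M%:R) ^+ n * pow2 (delta * (b i)%:~R - delta * a%:~R) `^ (n%:R / delta).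
  rewrite mem_filter => /andP[_ iF]; have [_ _ hM] := hF _ iF.
  have B0 := pow2_gt0 ((b i)%:~R : R).
  pose h := eps / 2 * t / M%:R; pose rho := pow2 (b i)%:~R + T / M%:R.
  have h0 : 0 < h by rewrite !mulr_gt0 ?invr_gt0.
  have rho0 : 0 <= rho by rewrite addr_ge0 ?pow2_ge0// divr_ge0// ltW.
  have := @card_lattice_cube R n M (fun j => z0 ord0 j) (fun j => y i ord0 j) h rho h0 rho0.
  set c := #|[pred v | _]| => hc.
  apply: (@le_trans _ _ c%:R).
    rewrite ler_nat; apply: subset_leq_card; apply/fintype.subsetP => om; rewrite !inE => hom.
    apply/forallP => j.
    have h2 := hxi om j; have h3 := le_lt_trans (le_enorm (xi om - y i) j) hom.
    have -> : h * (om j)%:R = eps / 2 * t * ((om j)%:R / M%:R) by rewrite /h; ring.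
    move: h2 h3; rewrite !mxE !ler_norml ltr_norml /rho.
    move: (eps / 2 * t * _) => e /andP[h21 h22] /andP[h31 h32].
    by apply/andP; split; lra.
  apply: (le_trans hc); rewrite pow2_powR.
  have -> : (delta * (b i)%:~R - delta * a%:~R) * (n%:R / delta) = ((b i)%:~R - a%:~R) * n%:R.
    by field; exact: lt0r_neq0.
  rewrite -pow2_powR powR_mulrn ?pow2_ge0// -exprMn.
  have rh : 0 <= 2 * rho / h by rewrite divr_ge0 ?mulr_ge0// ltW.
  have l1 : 0 <= 2 * rho / h + 1 by rewrite addr_ge0.
  have l2 : 0 <= (16 / eps + 1) * M%:R * pow2 ((b i)%:~R - a%:~R).
    by rewrite mulr_ge0 ?pow2_ge0// mulr_ge0.
  rewrite lerXn2r ?nnegrE//.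
  have -> : (16 / eps + 1) * M%:R * pow2 ((b i)%:~R - a%:~R) =
     16 * M%:R * pow2 (b i)%:~R / (eps * T) + M%:R * pow2 (b i)%:~R / T.
    by rewrite pow2B -/T; field; rewrite !gt_eqF.
  apply: lerD; last by rewrite ler_pdivlMr// mul1r.
  rewrite ler_pdivrMr// /h.
  have -> : 16 * M%:R * pow2 (b i)%:~R / (eps * T) * (eps / 2 * t / M%:R) = 8 * pow2 (b i)%:~R * (t / T).
    by field; rewrite !gt_eqF.
  have tT : 1 / 2 <= t / T by rewrite ler_pdivlMr//; lra.
  have hr : T / M%:R <= pow2 (b i)%:~R by rewrite ler_pdivrMr// mulrC.
  rewrite /rho; nra.
have card_le : #|[pred om | has (fun i => enorm (xi om - y i) < pow2 (b i)%:~R) F]|%:R <=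
    \sum_(i <- F') #|meets i|%:R :> R.
  rewrite -natr_sum ler_nat.
  have -> : (\sum_(i <- F') #|meets i| = \sum_(i <- F') \sum_(om | meets i om) 1)%N.
    by apply: eq_bigr => i _; rewrite sum1_card.
  rewrite (exchange_big_dep xpredT)//= -sum1_card big_mkcond/=.
  apply: leq_sum => om _; rewrite inE; case: ifP => // /hasP[i iF hi].
  have iF' : i \in F' by rewrite mem_filter iF andbT; apply/existsP; exists om.
  by rewrite (big_rem i)//= hi.
have q1 : 1 <= n%:R / delta by rewrite ler_pdivlMr// mul1r.
have q0 : 0 <= n%:R / delta by exact: le_trans q1.
have main : #|[pred om | has (fun i => enorm (xi om - y i) < pow2 (b i)%:~R) F]|%:R <=
    ((16 / eps + 1) * M%:R) ^+ n * (pow2 (- (delta * a%:~R)) * S) `^ (n%:R / delta).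
  apply: (le_trans card_le).
  apply: (@le_trans _ _ (((16 / eps + 1) * M%:R) ^+ n *
     \sum_(i <- F') (pow2 (delta * (b i)%:~R - delta * a%:~R)) `^ (n%:R / delta))).
    by rewrite mulr_sumr big_seq [leRHS]big_seq; apply: ler_sum => i iF'; exact: card_meets.
  apply: ler_wpM2l; first by rewrite exprn_ge0// mulr_ge0// ltW.
  rewrite /S mulr_sumr.
  under [in leRHS]eq_bigr do rewrite -pow2D addrC.
  by apply: sum_powR_le => // i; exact: pow2_ge0.
have triv : #|[pred om | has (fun i => enorm (xi om - y i) < pow2 (b i)%:~R) F]|%:R <= M%:R ^+ n :> R.
  rewrite -natrX ler_nat; apply: leq_trans (max_card _) _.
  by rewrite card_ffun !card_ord.
have B1 := density_const_ge1.
have rate0 : 0 < rate by apply: lt_trans rate_gt1.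
(* Below the threshold the asserted density exceeds one. *)
have low : k%:~R <= log_mean m a -> #|[pred om | has (fun i => enorm (xi om - y i) < pow2 (b i)%:~R) F]|%:R <=
    M%:R ^+ n * (density_const * pow2 (rate * (log_mean m a - k%:~R))).
  move=> hk; apply: (le_trans triv); rewrite ler_peMr ?exprn_ge0//; apply: mulr_ege1 => //.
  by rewrite pow2_ge1 mulr_ge0 ?subr_ge0// ltW.
have [/low//|klt] := leP k%:~R (log_mean m a).
apply: (le_trans main); rewrite exprMn [_ ^+ n * M%:R ^+ n]mulrC -mulrA.
rewrite ler_pM2l ?exprn_gt0//.
have -> th : density_const * pow2 (rate * th) = (16 / eps + 1) ^+ n *
    ((5 ^+ n) `^ (n%:R / delta) * pow2 (2 * n%:R + rate * th)).
  by rewrite /density_const pow2D; move: (pow2 (rate * th)) => P; rewrite !mulrA.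
apply: ler_wpM2l; first by rewrite exprn_ge0.
have S0 : 0 <= pow2 (- (delta * a%:~R)) * S.
  by rewrite mulr_ge0 ?pow2_ge0// sumr_ge0// => *; exact: pow2_ge0.
pose th1 : R := m%:~R - kappa * (a + 2)%:~R; pose th := (w - delta * a%:~R) / p.
have [e|e] : log_mean m a = th1 \/ log_mean m a = th.
  by rewrite /log_mean minEle; case: ifP; [left|right].
all: rewrite e in klt *.
  have hS := near_mass_le p10 kappa0 far uF' hF' (ltW klt).
  apply: (@le_trans _ _ ((5 ^+ n * pow2 (p1 * (m%:~R - kappa * (a + 2)%:~R - k%:~R) + 2 * delta)) `^ (n%:R / delta))).
    apply: ge0_ler_powR => //; rewrite ?nnegrE//.
      by rewrite mulr_ge0 ?pow2_ge0// exprn_ge0.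
    apply: (@le_trans _ _ (pow2 (- (delta * a%:~R)) * (5 ^+ n * pow2 (p1 * (m%:~R - kappa * (a + 2)%:~R - k%:~R) + delta * (a + 2)%:~R)))).
      by apply: ler_wpM2l; rewrite ?pow2_ge0.
    rewrite mulrCA -pow2D ler_pM2l ?exprn_gt0// pow2_le intrD; lra.
  rewrite powRM ?pow2_ge0 ?exprn_ge0// pow2_powR; apply: ler_wpM2l; first exact: powR_ge0.
  rewrite pow2_le /rate -/th1 le_eqVlt; apply/orP; left; apply/eqP; field; exact: lt0r_neq0.
have hS := level_mass_le mass uF' (fun i hi => let: And3 a b _ := hF' i hi in conj a b).
apply: (@le_trans _ _ (pow2 ((w - p * k%:~R - delta * a%:~R) * (n%:R / delta)))).
  rewrite -pow2_powR; apply: ge0_ler_powR => //; rewrite ?nnegrE ?pow2_ge0//.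
  rewrite [in leRHS]addrC pow2D; apply: ler_wpM2l; rewrite ?pow2_ge0//.
apply: (@le_trans _ _ (1 * pow2 (2 * n%:R + rate * (th - k%:~R)))); last first.
  apply: ler_wpM2r; first exact: pow2_ge0.
  have h : (1 : R) <= 5 ^+ n by rewrite exprn_ege1// ler1n.
  by rewrite -[leLHS](powRr0 (5 ^+ n)) ler_powR.
rewrite mul1r pow2_le.
have -> : w - p * k%:~R - delta * a%:~R = p * (th - k%:~R).
  by rewrite /th mulrBr mulrCA mulfV ?mulr1 ?gt_eqF//; ring.
have -> : p * (th - k%:~R) * (n%:R / delta) = rate * (th - k%:~R) + (p - p1) * (n%:R / delta) * (th - k%:~R).
  by rewrite /rate; ring.
have : (p - p1) * (n%:R / delta) * (th - k%:~R) <= 0.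
  apply: mulr_ge0_le0; last by rewrite subr_le0 ltW.
  by rewrite mulr_ge0// subr_ge0 ltW.
have : 0 <= 2 * n%:R :> R by [].
lra.
Qed.

End lattice.

(** * Oscillation along a curve *)

Section lattice_curve.
Context (R : realType) (n : nat) (delta kappa p p1 eps : R).
Hypothesis n0 : (0 < n)%N.
Hypothesis delta0 : 0 < delta.
Hypothesis deltan : delta <= n%:R.
Hypothesis kappa0 : 0 <= kappa.
Hypothesis p1gt : delta / n%:R < p1.
Hypothesis p1p : p1 < p.
Hypothesis eps0 : 0 < eps.
Hypothesis eps1 : eps <= 1.
Context (D : set (int * nat)) (y : int * nat -> 'rV[R]_n) (b : int * nat -> int).
Context (w : R).
Hypothesis mass : (\esum_(i in D) (pow2 (p * i.1%:~R + delta * (b i)%:~R))%:E <= (pow2 w)%:E)%E.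

Local Notation rate := (rate n delta p1).
Local Notation density_const := (density_const n delta eps).
Local Notation log_mean := (log_mean delta kappa p w).

Definition lattice_point (gamma : R -> 'rV[R]_n) (M : nat) (t : R)
    (om : {ffun 'I_n -> 'I_M}) : 'rV[R]_n :=
  \row_i (gamma t ord0 i + eps / 2 * t * ((om i)%:R / M%:R)).

Definition lattice_mean (u : 'rV[R]_n -> R) (gamma : R -> 'rV[R]_n) (M : nat) (t : R) : R :=
  (M%:R ^+ n)^-1 * \sum_om u (@lattice_point gamma M t om).

(** The means of [f] over the perturbed lattice, by summing the densities of its
level sets. Values below [2 ^ k0] contribute the first term. *)
Lemma level_mean_le (C : R) :
  (forall (B theta k0 : R) (N : nat) (phi : nat -> R), 1 <= B ->
    (forall j, (j < N)%N -> phi j <= 1 /\ phi j <= B * pow2 (rate * (theta - (k0 + j%:R)))) ->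
    \sum_(0 <= j < N) pow2 (k0 + j%:R) * phi j <= B * C * pow2 theta) ->
  forall (x z0 : 'rV[R]_n) (m a k0 : int) (N : nat) (t : R) (M : nat)
    (xi : {ffun 'I_n -> 'I_M} -> 'rV[R]_n) (F : nat -> seq (int * nat)) (f : 'rV[R]_n -> R),
  ~ near_heavy delta kappa p1 D y b m x ->
  pow2 a%:~R / 2 <= t <= pow2 a%:~R -> (0 < M)%N ->
  (forall i, `|z0 ord0 i - x ord0 i| <= t) ->
  (forall om i, `|xi om ord0 i - (z0 ord0 i + eps / 2 * t * ((om i)%:R / M%:R))| <= pow2 a%:~R / M%:R) ->
  (forall om, f (xi om) <= pow2 (k0%:~R + N%:R)) ->
  (forall j, (j < N)%N -> [/\ uniq (F j),
     (forall i, i \in F j -> [/\ D i, i.1 = k0 + j%:Z - 1 & (pow2 a%:~R : R) <= M%:R * pow2 (b i)%:~R]) &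
     forall om, pow2 (k0 + j%:Z)%:~R <= f (xi om) ->
        exists2 i, i \in F j & eball (y i) (pow2 (b i)%:~R) (xi om)]) ->
  \sum_om f (xi om) <=
    M%:R ^+ n * (pow2 k0%:~R + density_const * pow2 rate * C * pow2 (log_mean m a)).
Proof.
move=> hC x z0 m a k0 N t M xi F f far ht M0 hx hxi fK hF.
have MR : 0 < M%:R :> R by rewrite ltr0n.
have MRn : 0 < M%:R ^+ n :> R by rewrite exprn_gt0.
pose phi (j : nat) : R := #|[pred om | pow2 (k0%:~R + j%:R) < f (xi om)]|%:R / M%:R ^+ n.
apply: (@le_trans _ _ (\sum_om (pow2 k0%:~R + \sum_(0 <= j < N) pow2 (k0%:~R + j%:R) *
    (pow2 (k0%:~R + j%:R) < f (xi om))%R%:R))).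
  by apply: ler_sum => om _; apply: le_dyadic_layers.
have -> : \sum_om (pow2 k0%:~R + \sum_(0 <= j < N) pow2 (k0%:~R + j%:R) *
    (pow2 (k0%:~R + j%:R) < f (xi om))%R%:R) =
    M%:R ^+ n * (pow2 k0%:~R + \sum_(0 <= j < N) pow2 (k0%:~R + j%:R) * phi j).
  rewrite big_split/= sumr_const card_ffun !card_ord mulrDr -[_ *+ _]mulr_natl natrX.
  congr (_ + _); rewrite exchange_big/= mulr_sumr; apply: eq_bigr => j _.
  rewrite mulrCA /phi [M%:R ^+ n * (_ / _)]mulrC divfK ?gt_eqF// -mulr_sumr; congr (_ * _).
  rewrite -sum1_card natr_sum [RHS]big_mkcond/=; apply: eq_bigr => om _.
  by rewrite inE; case: (pow2 _ < _).
rewrite ler_pM2l// lerD2l; apply: hC.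
  by apply: mulr_ege1; [exact: density_const_ge1|rewrite pow2_ge1 ltW// (lt_trans ltr01)// rate_gt1].
move=> j jN; have [uFj hFj hcov] := hF j jN; rewrite /phi; split.
  rewrite ler_pdivrMr// mul1r -natrX ler_nat.
  by apply: leq_trans (max_card _) _; rewrite card_ffun !card_ord.
rewrite ler_pdivrMr// mulrC.
apply: (@le_trans _ _ (#|[pred om | has (fun i => enorm (xi om - y i) < pow2 (b i)%:~R) (F j)]|%:R)).
  rewrite ler_nat; apply: subset_leq_card; apply/fintype.subsetP => om; rewrite !inE => h.
  have [|i iF hi] := hcov om; first by rewrite intrD; exact: ltW.
  by apply/hasP; exists i.
have := lattice_density n0 delta0 deltan kappa0 p1gt p1p eps0 eps1 mass far ht M0 hx hxi uFj hFj.
move=> /le_trans; apply; rewrite ler_pM2l// -mulrA ler_wpM2l//.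
  by apply: le_trans (density_const_ge1 n delta0 eps0).
by rewrite -pow2D pow2_le !intrD mulrNz; lra.
Qed.

Context (Om : set 'rV[R]_n) (u : 'rV[R]_n -> R).
Hypothesis oOm : open Om.
Hypothesis uC1 : C1_on Om u.
Hypothesis cov : forall k x, Om x -> pow2 k%:~R < enorm (gradient u x) ->
  exists2 j, D (k, j) & eball (y (k, j)) (pow2 (b (k, j))%:~R) x.
Context (x : 'rV[R]_n) (m A : int) (gamma : R -> 'rV[R]_n).
Hypothesis far : ~ near_heavy delta kappa p1 D y b m x.
Hypothesis gamma0 : gamma 0 = x.
Hypothesis gamma_lip : forall (s t : R) i, 0 <= s -> s <= t -> t <= pow2 A%:~R ->
  `|gamma t ord0 i - gamma s ord0 i| <= t - s.
Hypothesis gamma_cube : forall (t : R) (z : 'rV[R]_n), 0 < t -> t <= pow2 A%:~R ->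
  (forall i, `|z ord0 i - gamma t ord0 i| <= eps * t) -> Om z.

Lemma seq_upper_bound (T : eqType) (F : seq T) (g : T -> R) :
  exists M : nat, forall i, i \in F -> g i <= M%:R.
Proof.
elim: F => [|i F [M hM]]; first by exists 0%N.
exists (M + (Num.trunc `|g i|).+1)%N => j; rewrite inE natrD => /predU1P[->|/hM h].
  have /andP[_ h] := truncn_itv (normr_ge0 (g i)).
  have := ler_norm (g i); have : 0 <= M%:R :> R by []. lra.
by apply: (le_trans h); rewrite lerDl.
Qed.

(** During a step of length [2 ^ a / (2 M)] each lattice point moves by at most
[2 ^ a / M], the order of the mesh, and stays in a compact part of the domain. *)
Lemma segment_in_inner_cube (a : int) (t t' : R) (M : nat) om s :
  (0 < M)%N -> 8 / eps <= M%:R -> a <= A ->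
  pow2 a%:~R / 2 <= t -> t <= t' -> t' <= pow2 a%:~R -> t' - t <= pow2 a%:~R / (2 * M%:R) ->
  0 <= s <= 1 ->
  let P := @lattice_point gamma M t om in let Q := @lattice_point gamma M t' om in
  [/\ forall i, `|Q ord0 i - P ord0 i| <= pow2 a%:~R / M%:R,
      forall i, `|(P + s *: (Q - P)) ord0 i - P ord0 i| <= pow2 a%:~R / M%:R &
      inner_cube Om x (3 * pow2 a%:~R) (eps * pow2 a%:~R / 8) (P + s *: (Q - P))].
Proof.
move=> M0 hM aA h1 h2 h3 h4 /andP[s0 s1] P Q.
have MR : 0 < M%:R :> R by rewrite ltr0n.
have T0 := pow2_gt0 (a%:~R : R); have TA : pow2 a%:~R <= pow2 A%:~R :> R by rewrite pow2_le ler_int.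
set T := pow2 a%:~R in T0 TA h1 h3 h4 *.
have t0 : 0 < t by apply: lt_le_trans h1; rewrite divr_gt0.
have q j : 0 <= ((om j)%:R / M%:R : R) <= 1.
  by rewrite divr_ge0//= ler_pdivrMr// mul1r ler_nat ltnW.
have h4' : t' - t <= T / M%:R / 2.
  by apply: (le_trans h4); rewrite invfM mulrA mulrAC.
have TM : T / M%:R <= eps * T / 8.
  rewrite ler_pdivrMr//; move: hM; rewrite ler_pdivrMr// => hM.
  have := ler_wpM2l (ltW T0) hM; lra.
have PQ i : `|Q ord0 i - P ord0 i| <= T / M%:R.
  rewrite !mxE.
  have g1 := gamma_lip i (ltW t0) h2 (le_trans h3 TA).
  have := q i; move: (_ / _) => r /andP[r0 r1].
  have -> : gamma t' ord0 i + eps / 2 * t' * r - (gamma t ord0 i + eps / 2 * t * r) =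
    (gamma t' ord0 i - gamma t ord0 i) + (t' - t) * (eps / 2 * r) by ring.
  apply: (le_trans (ler_normD _ _)).
  have -> : T / M%:R = T / M%:R / 2 + T / M%:R / 2 by rewrite -splitr.
  apply: lerD; first exact: le_trans h4'.
  have er : 0 <= eps / 2 * r <= 1.
    rewrite mulr_ge0 ?divr_ge0 ?(ltW eps0)//=.
    have e1 : eps / 2 <= 1 by rewrite ler_pdivrMr// mul1r (le_trans eps1)// ler1n.
    rewrite -[leRHS]mulr1; apply: ler_pM => //; rewrite divr_ge0// ltW//.
  move: er => /andP[er0 er1].
  rewrite normrM ger0_norm ?subr_ge0// ger0_norm//.
  apply: le_trans h4'; rewrite -[leRHS]mulr1; apply: ler_wpM2l => //; rewrite subr_ge0//.
have xiP i : `|(P + s *: (Q - P)) ord0 i - P ord0 i| <= T / M%:R.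
  have -> : (P + s *: (Q - P)) ord0 i - P ord0 i = s * (Q ord0 i - P ord0 i).
    by rewrite !mxE; ring.
  rewrite normrM ger0_norm//; apply: le_trans (PQ i).
  by rewrite ler_piMl.
have Pg i : `|P ord0 i - gamma t ord0 i| <= eps / 2 * t.
  rewrite mxE addrC addKr; have := q i; move: (_ / _) => r /andP[r0 r1].
  have et : 0 <= eps / 2 * t by rewrite mulr_ge0 ?(ltW t0)// divr_ge0// ltW.
  rewrite ger0_norm; last exact: mulr_ge0.
  by rewrite -[leRHS]mulr1; exact: ler_wpM2l.
have et : eps * T / 2 <= eps * t.
  by rewrite -mulrA; apply: ler_wpM2l => //; exact: ltW.
have tT : t <= T by exact: le_trans h3.
have epst : eps * t <= T by apply: le_trans tT; rewrite ler_piMl// ltW.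
have epsT : eps * T <= T by rewrite ler_piMl// ltW.
split=> //; split.
  move=> i; have g0 := gamma_lip i (lexx 0) (ltW t0) (le_trans tT TA).
  rewrite gamma0 subr0 in g0; have := xiP i; have := Pg i.
  move: ((P + s *: (Q - P)) ord0 i) (P ord0 i) g0 => z1 z2.
  have tM : 0 < T / M%:R by rewrite divr_gt0.
  rewrite !ler_norml => /andP[a1 a2] /andP[a3 a4] /andP[a5 a6].
  by apply/andP; split; lra.
move=> z nz; rewrite leNgt; apply/negP => hz; apply: nz.
apply: (gamma_cube t0 (le_trans tT TA)) => i.
have := le_lt_trans (coord_le_norm (P + s *: (Q - P) - z) i) hz.
rewrite [(_ - z) ord0 i]mxE [(- z) ord0 i]mxE; have := xiP i; have := Pg i.
move: ((P + s *: (Q - P)) ord0 i) (P ord0 i) => z1 z2.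
rewrite !ler_norml ltr_norml => /andP[a1 a2] /andP[a3 a4] /andP[a5 a6].
by apply/andP; split; lra.
Qed.

(** During each of the [M] steps from the time [2 ^ a / 2] to the time [2 ^ a], the mean
of [u] over the moving lattice varies by at most a multiple of the length of the
step times the mean of [f] over intermediate points given by the mean value
theorem. These are a perturbation of the lattice by the order of its mesh, so
their density in balls much larger than the mesh is under control; compactness
reduces the cover to finitely many balls, and [M] is taken large with respect to
their radii. *)
Lemma block_oscillation (C : R) (a : int) : 0 <= C ->
  (forall (B theta k0 : R) (N : nat) (phi : nat -> R), 1 <= B ->
    (forall j, (j < N)%N -> phi j <= 1 /\ phi j <= B * pow2 (rate * (theta - (k0 + j%:R)))) ->
    \sum_(0 <= j < N) pow2 (k0 + j%:R) * phi j <= B * C * pow2 theta) ->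
  a <= A -> exists M0 : nat, forall M, (M0 <= M)%N ->
  `|lattice_mean u gamma M (pow2 a%:~R) - lattice_mean u gamma M (pow2 a%:~R / 2)| <=
    n%:R * (1 + density_const * pow2 rate * C) * pow2 (a%:~R + log_mean m a).
Proof.
move=> C0 hC aA; set T := pow2 a%:~R; have T0 : 0 < T by exact: pow2_gt0.
pose K := inner_cube Om x (3 * T) (eps * T / 8).
pose f z := enorm (gradient u z).
have f0 z : 0 <= f z by exact: sqrtr_ge0.
have cK : compact K by apply: inner_cube_compact; rewrite mulr_ge0// ltW.
have KO : K `<=` Om by apply: inner_cube_sub; rewrite divr_gt0// mulr_gt0.
have cf z : Om z -> {for z, continuous f} by exact: continuous_enorm_gradient.
(* Finitely many levels matter: [f] is at most [2 ^ k1] on [K], and the values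
below [2 ^ k0] contribute no more than the bound to be proved. *)
have [k1 hk1] : exists k1 : int, forall z, K z -> f z <= pow2 k1%:~R.
  have [[z0 Kz0]|nK] := pselect (K !=set0); last first.
    by exists 0 => z Kz; case: nK; exists z.
  have [z1 _ hz1] : exists2 c, c \in K & forall t, t \in K -> f t <= f c.
    apply: EVT_max_rV => //; first by exists z0.
    by apply: continuous_in_subspaceT => z; rewrite inE => /KO; exact: cf.
  have [k hk] := pow2_unbounded (f z1); exists k%:Z => z Kz.
  by apply: le_trans (ltW hk); apply: hz1; rewrite inE.
have [k0 [k0th k01]] : exists k0 : int, pow2 k0%:~R <= pow2 (log_mean m a) /\ k0 <= k1.
  exists (Num.min (Num.floor (log_mean m a)) k1); rewrite pow2_le; split.
    by apply: le_trans (floor_le _); rewrite ler_int ge_min lexx.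
  by rewrite ge_min lexx orbT.
have [N kN] : exists N : nat, k0 + N%:Z = k1.
  by exists `|k1 - k0|%N; rewrite gez0_abs ?subr_ge0// [k0 + _]addrC subrK.
have /choice[F hF] := finite_level_cover oOm cf cK KO cov.
(* [Mb] makes the mesh finer than the radii of all the balls used, [M8] makes the
steps small with respect to the distance from [K] to the complement. *)
have [Mb hMb] := seq_upper_bound (flatten [seq F (k0 + j%:Z) | j <- iota 0 N])
  (fun i => T / pow2 (b i)%:~R).
have [M8 hM8] := seq_upper_bound [:: tt] (fun=> 8 / eps).
exists (Mb + M8 + 1)%N => M hM.
have M0 : (0 < M)%N by rewrite (leq_trans _ hM)// addn1.
have MR : 0 < M%:R :> R by rewrite ltr0n.
have MRn : 0 < M%:R ^+ n :> R by rewrite exprn_gt0.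
have M8M : 8 / eps <= M%:R by apply: le_trans (hM8 tt _) _; rewrite ?inE// ler_nat (leq_trans _ hM)// -addnA addnCA leq_addr.
have MbM : Mb%:R <= M%:R :> R by rewrite ler_nat (leq_trans _ hM)// -addnA leq_addr.
have step t t' : T / 2 <= t -> t <= t' -> t' <= T -> t' - t <= T / (2 * M%:R) ->
  `|lattice_mean u gamma M t' - lattice_mean u gamma M t| <=
    n%:R * (T / M%:R) * (pow2 k0%:~R + density_const * pow2 rate * C * pow2 (log_mean m a)).
  move=> h1 h2 h3 h4.
  have seg om s hs := @segment_in_inner_cube a t t' M om s M0 M8M aA h1 h2 h3 h4 hs.
  have : forall om : {ffun 'I_n -> 'I_M}, exists z : 'rV[R]_n,
    [/\ forall i, `|z ord0 i - lattice_point gamma t om ord0 i| <= T / M%:R, K z &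
        `|u (lattice_point gamma t' om) - u (lattice_point gamma t om)| <=
           n%:R * (T / M%:R) * f z].
    move=> om; have [PQ _ _] := seg om 0 (introT andP (conj (lexx 0) ler01)).
    have [s hs hu] := mean_value_coord PQ (fun s hs => uC1.1 _ (KO _ (let: And3 _ _ h := seg om s hs in h))).
    have [_ hz Kz] := seg om s hs.
    by exists (lattice_point gamma t om + s *: (lattice_point gamma t' om - lattice_point gamma t om)).
  move=> /choice[xi hxi].
  rewrite /lattice_mean -mulrBr normrM gtr0_norm ?invr_gt0// mulrC ler_pdivrMr// -sumrB.
  apply: (le_trans (ler_norm_sum _ _ _)).
  apply: (@le_trans _ _ (\sum_om n%:R * (T / M%:R) * f (xi om))).
    by apply: ler_sum => om _; have [] := hxi om.
  rewrite -mulr_sumr -[leRHS]mulrA; apply: ler_wpM2l.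
    by rewrite mulr_ge0// divr_ge0// ltW.
  rewrite [leRHS]mulrC.
  have tT : t <= T by exact: le_trans h3.
  have t0 : 0 < t by apply: lt_le_trans h1; rewrite divr_gt0.
  have TA : T <= pow2 A%:~R by rewrite pow2_le ler_int.
  apply: (@level_mean_le C hC x (gamma t) m a k0 N t M xi (fun j => F (k0 + j%:Z)) f) => //.
  - by rewrite h1.
  - by move=> i; have := gamma_lip i (lexx 0) (ltW t0) (le_trans tT TA); rewrite gamma0 subr0.
  - by move=> om i; have [h _ _] := hxi om; have := h i; rewrite mxE.
  - move=> om; have [_ Kz _] := hxi om; apply: (le_trans (hk1 _ Kz)).
    by rewrite -kN intrD.
  - move=> j jN; have [uF hF1 hF2] := hF (k0 + j%:Z); split=> //.
      move=> i iF; have [Di ik] := hF1 i iF; split=> //.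
      rewrite -ler_pdivrMr ?pow2_gt0//; apply: le_trans MbM; apply: hMb.
      apply/flattenP; exists (F (k0 + j%:Z)) => //; apply/mapP; exists j => //.
      by rewrite mem_iota.
    by move=> om hom; have [_ Kz _] := hxi om; exact: hF2.
pose t (j : nat) := T / 2 + j%:R * (T / (2 * M%:R)).
have tS j : t j.+1 - t j = T / (2 * M%:R) by rewrite /t -natr1; ring.
have d0 : 0 <= T / (2 * M%:R) by rewrite divr_ge0 ?mulr_ge0// ltW.
have tM : t M = T by rewrite /t; field; rewrite gt_eqF.
have t0 : t 0%N = T / 2 by rewrite /t mul0r addr0.
have tj j : (j <= M)%N -> T / 2 <= t j <= T.
  move=> jM; rewrite /t lerDl mulr_ge0//= -[leRHS]tM /t lerD2l.
  by apply: ler_wpM2r => //; rewrite ler_nat.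
rewrite -{1}tM -t0 -(telescope_sumr (fun j => lattice_mean u gamma M (t j)) (leq0n M)).
apply: (le_trans (ler_norm_sum _ _ _)).
apply: (@le_trans _ _ (\sum_(0 <= j < M) n%:R * (T / M%:R) *
  (pow2 k0%:~R + density_const * pow2 rate * C * pow2 (log_mean m a)))).
  apply: ler_sum_nat => j /andP[_ jM]; have /andP[a1 a2] := tj j (ltnW jM).
  have /andP[a3 a4] := tj j.+1 jM.
  by apply: step => //; [rewrite -subr_ge0 tS|rewrite tS].
rewrite sumr_const_nat subn0 -[leLHS]mulr_natl.
have -> : M%:R * (n%:R * (T / M%:R) * (pow2 k0%:~R + density_const * pow2 rate * C * pow2 (log_mean m a))) =
   n%:R * T * (pow2 k0%:~R + density_const * pow2 rate * C * pow2 (log_mean m a)).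
  by move: (_ + _) => X; field; rewrite gt_eqF.
rewrite pow2D -/T.
have -> : n%:R * (1 + density_const * pow2 rate * C) * (T * pow2 (log_mean m a)) =
  n%:R * T * (pow2 (log_mean m a) + density_const * pow2 rate * C * pow2 (log_mean m a)).
  by move: (density_const * _ * _) => X; ring.
by rewrite ler_wpM2l ?lerD2r// mulr_ge0// ltW.
Qed.

End lattice_curve.

(** At [a = (w / p - m) / (delta / p - kappa)] the two bounds in [log_mean] agree, up to
bounded terms; this is the logarithm of their common value times [2 ^ a]. *)
Definition log_oscillation (R : realType) (delta kappa p w m : R) : R :=
  m + (1 - kappa) * ((w / p - m) / (delta / p - kappa)).

(** The two bounds have slopes of opposite signs in [a] after multiplication by
[2 ^ a], since [kappa < 1] and [p < delta]. *)
Lemma scale_log_mean_le (R : realType) (delta kappa p w : R) (m a : int) :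
  0 <= kappa -> kappa < 1 -> 0 < p -> p < delta ->
  a%:~R + log_mean delta kappa p w m a <=
  log_oscillation delta kappa p w m%:~R +
   - (Num.min (1 - kappa) (delta / p - 1) *
      `|a%:~R - (w / p - m%:~R) / (delta / p - kappa)|).
Proof.
move=> k0 k1 p0 pd; set e := Num.min _ _.
have s0 : 0 < 1 - kappa by rewrite subr_gt0.
have t0 : 0 < delta / p - 1 by rewrite subr_gt0 ltr_pdivlMr// mul1r.
have st : 0 < delta / p - kappa by lra.
have es : e <= 1 - kappa by rewrite ge_min lexx.
have et : e <= delta / p - 1 by rewrite ge_min lexx orbT.
rewrite /log_oscillation; set z := (_ - _) / _.
have hz : (delta / p - kappa) * z = w / p - m%:~R by rewrite mulrC divfK// gt_eqF.
have [az|za] := leP a%:~R z.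
  rewrite ler0_norm ?subr_le0//.
  have : log_mean delta kappa p w m a <= m%:~R - kappa * a%:~R.
    by rewrite /log_mean ge_min lerD2l lerN2 ler_wpM2l// ler_int lerDl.
  have := ler_wpM2r (_ : 0 <= z - a%:~R) es; rewrite subr_ge0 => /(_ az); lra.
rewrite gtr0_norm ?subr_gt0//.
have : log_mean delta kappa p w m a <= w / p - delta / p * a%:~R.
  rewrite /log_mean ge_min; apply/orP; right.
  by rewrite mulrBl mulrAC.
have := ler_wpM2r (_ : 0 <= a%:~R - z) et; rewrite subr_ge0 => /(_ (ltW za)).
move: (w / p) hz => wp hz; lra.
Qed.

Lemma lattice_mean_end (R : realType) n (eps : R) (u : 'rV[R]_n -> R) gamma M t :
  lattice_mean eps u gamma M t = lattice_mean eps u (fun=> gamma t) M t.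
Proof. by []. Qed.

Lemma lattice_mean_near (R : realType) n (eps : R) (u : 'rV[R]_n -> R) gamma (M : nat) t c eta :
  (0 < M)%N -> (forall om, `|u (lattice_point eps gamma (M := M) t om) - c| <= eta) ->
  `|lattice_mean eps u gamma M t - c| <= eta.
Proof.
move=> M0 h; have MRn : 0 < M%:R ^+ n :> R by rewrite exprn_gt0// ltr0n.
have -> : lattice_mean eps u gamma M t - c =
   (M%:R ^+ n)^-1 * \sum_om (u (lattice_point eps gamma (M := M) t om) - c).
  rewrite /lattice_mean sumrB mulrBr; congr (_ - _).
  by rewrite sumr_const card_ffun !card_ord -[c *+ _]mulr_natl natrX mulKf// gt_eqF.
rewrite normrM gtr0_norm ?invr_gt0// mulrC ler_pdivrMr//.
apply: (le_trans (ler_norm_sum _ _ _)).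
apply: (le_trans (ler_sum _ (fun om _ => h om))).
by rewrite sumr_const card_ffun !card_ord -[leLHS]mulr_natl natrX mulrC.
Qed.

(** The mean over the last lattice depends only on the center, and the mean over a
lattice close to [x] is close to [u x]; in between, the blocks give a two-sided
geometric series. The mesh [1 / M] depends on [x], but any two points can be
compared through a common one. *)
Lemma point_oscillation (R : realType) (n : nat) (delta kappa p p1 eps : R) :
  (0 < n)%N -> 0 < delta -> delta <= n%:R -> 0 <= kappa -> kappa < 1 ->
  delta / n%:R < p1 -> p1 < p -> p < delta -> 0 < eps -> eps <= 1 ->
  exists2 C : R, 0 < C &
  forall (D : set (int * nat)) (y : int * nat -> 'rV[R]_n) (b : int * nat -> int) (w : R),
  (\esum_(i in D) (pow2 (p * i.1%:~R + delta * (b i)%:~R))%:E <= (pow2 w)%:E)%E ->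
  forall (Om : set 'rV[R]_n) (u : 'rV[R]_n -> R),
  open Om -> C1_on Om u ->
  (forall k x, Om x -> pow2 k%:~R < enorm (gradient u x) ->
     exists2 j, D (k, j) & eball (y (k, j)) (pow2 (b (k, j))%:~R) x) ->
  forall (x : 'rV[R]_n) (m A : int) (gamma : R -> 'rV[R]_n),
  Om x -> ~ near_heavy delta kappa p1 D y b m x -> gamma 0 = x ->
  (forall (s t : R) i, 0 <= s -> s <= t -> t <= pow2 A%:~R ->
    `|gamma t ord0 i - gamma s ord0 i| <= t - s) ->
  (forall (t : R) (z : 'rV[R]_n), 0 < t -> t <= pow2 A%:~R ->
    (forall i, `|z ord0 i - gamma t ord0 i| <= eps * t) -> Om z) ->
  forall eta : R, 0 < eta -> exists M0 : nat, forall M, (M0 <= M)%N ->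
    `|u x - lattice_mean eps u (fun=> gamma (pow2 A%:~R)) M (pow2 A%:~R)| <=
      eta + C * pow2 (log_oscillation delta kappa p w m%:~R).
Proof.
move=> n0 delta0 deltan k0 k1 p1gt p1p pd eps0 eps1.
have p10 : 0 < p1 by exact: p1_gt0 p1gt.
have p0 : 0 < p by exact: lt_trans p1p.
have [C1 C10 hC1] := sum_density_le (rate_gt1 n0 delta0 p1gt).
pose e := Num.min (1 - kappa) (delta / p - 1).
have e0 : 0 < e by rewrite lt_min !subr_gt0 k1 ltr_pdivlMr// mul1r.
have [C2 C20 hC2] := sum_pow2_two_sided_range e0.
pose E := n%:R * (1 + density_const n delta eps * pow2 (rate n delta p1) * C1).
have dc1 := density_const_ge1 n delta0 eps0.
have E0 : 0 < E.
  have dc0 : 0 < density_const n delta eps by exact: lt_le_trans dc1.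
  by rewrite mulr_gt0 ?ltr0n// addr_gt0// mulr_gt0// mulr_gt0// pow2_gt0.
exists (E * C2); first exact: mulr_gt0.
move=> D y b w mass Om u oOm uC1 cov x m A gamma Ox far g0 glip gcube eta eta0.
pose U M t := lattice_mean eps u gamma M t.
pose T (i : nat) : R := pow2 (A%:~R - i%:R).
have T0 i : 0 < T i by exact: pow2_gt0.
have TA i : T i <= pow2 A%:~R by rewrite pow2_le gerBl.
have Ti i : pow2 (A - i%:Z)%:~R = T i by rewrite intrB.
have TS i : T i / 2 = T i.+1.
  have e1 : A%:~R - i.+1%:R = A%:~R - i%:R - 1 :> R by rewrite -natr1; ring.
  by rewrite /T e1 [RHS]pow2B pow21.
have cu : {for x, continuous u} by apply: differentiable_continuous; exact: uC1.1.
have [r r0 hr] : exists2 r : R, 0 < r & forall z : 'rV[R]_n, (forall i, `|z ord0 i - x ord0 i| < r) -> `|u z - u x| <= eta.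
  have := cu (ball (u x) eta) (nbhsx_ballx _ _ eta0) => /nbhs_cubeP[r r0 hr].
  by exists r => // z /hr; rewrite /ball/= distrC => /ltW.
have r1 : 0 < r / (2 * pow2 A%:~R) by rewrite divr_gt0// mulr_gt0// pow2_gt0.
have [I hI] := pow2_small r1.
have TI : 2 * T I < r.
  move: (hI); rewrite ltr_pdivlMr ?mulr_gt0 ?pow2_gt0// /T pow2D; lra.
have blk (i : nat) : exists M0 : nat, forall M, (M0 <= M)%N ->
    `|U M (T i) - U M (T i.+1)| <= E * pow2 ((A - i%:Z)%:~R + log_mean delta kappa p w m (A - i%:Z)).
  have Ai : A - i%:Z <= A by rewrite gerBl.
  have := block_oscillation n0 delta0 deltan k0 p1gt p1p eps0 eps1 mass oOm uC1 cov far g0 glip gcube (ltW C10) hC1 Ai.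
  by rewrite Ti TS.
have [M0 hM0] := choice blk.
exists ((\max_(i < I) M0 i).+1)%N => M hM.
have Mpos : (0 < M)%N by exact: leq_ltn_trans hM.
have M0M i : (i < I)%N -> (M0 i <= M)%N.
  move=> iI; apply: leq_trans (ltnW hM).
  exact: (leq_bigmax_cond (F := fun i : 'I_I => M0 i) (Ordinal iI)).
have -> : lattice_mean eps u (fun=> gamma (pow2 A%:~R)) M (pow2 A%:~R) = U M (T 0%N).
  by rewrite /U /T subr0 [RHS]lattice_mean_end.
have h1 : `|U M (T I) - u x| <= eta.
  apply: lattice_mean_near => // om; apply: hr => i; rewrite mxE.
  have gx := glip 0 (T I) i (lexx 0) (ltW (T0 I)) (TA I); rewrite g0 subr0 in gx.
  have q : 0 <= ((om i)%:R / M%:R : R) <= 1.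
    by rewrite divr_ge0//= ler_pdivrMr ?ltr0n// mul1r ler_nat ltnW.
  move: (_ / M%:R) q => c /andP[c0 c1].
  have ec : 0 <= eps / 2 * T I * c <= T I / 2.
    have h : 0 <= eps / 2 * T I by rewrite mulr_ge0// ?divr_ge0// ltW.
    have h' : eps / 2 * T I <= T I / 2.
      by rewrite mulrAC ler_pM2r ?invr_gt0// ler_piMl// ltW.
    rewrite mulr_ge0//=; apply: le_trans h'; rewrite -[leRHS]mulr1; exact: ler_wpM2l.
  move: ec => /andP[ec0 ec1]; have := T0 I.
  move: gx; rewrite ler_norml ltr_norml => /andP[a1 a2] tI.
  by apply/andP; split; lra.
have h2 : `|U M (T 0%N) - U M (T I)| <= E * C2 * pow2 (log_oscillation delta kappa p w m%:~R).
  rewrite distrC -(telescope_sumr (fun i => U M (T i)) (leq0n I)).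
  apply: (le_trans (ler_norm_sum _ _ _)).
  apply: (@le_trans _ _ (\sum_(0 <= i < I) E * pow2 (log_oscillation delta kappa p w m%:~R) *
     pow2 (- (e * `|- A%:~R + i%:R - - ((w / p - m%:~R) / (delta / p - kappa))|)))).
    apply: ler_sum_nat => i /andP[_ iI]; rewrite distrC.
    apply: (le_trans (hM0 i M (M0M i iI))); rewrite -mulrA -pow2D ler_pM2l// pow2_le.
    apply: (le_trans (scale_log_mean_le w m (A - i%:Z) k0 k1 p0 pd)).
    rewrite -/e lerD2l lerN2 ler_pM2l// -normrN intrB.
    by rewrite le_eqVlt; apply/orP; left; apply/eqP; congr (`|_|); ring.
  rewrite -mulr_sumr -[leRHS]mulrA [C2 * _]mulrC mulrA.
  apply: ler_wpM2l; last exact: hC2.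
  by rewrite mulr_ge0 ?pow2_ge0// ltW.
have -> : u x - U M (T 0%N) = - (U M (T I) - u x) - (U M (T 0%N) - U M (T I)) by ring.
by apply: (le_trans (ler_normB _ _)); rewrite normrN lerD.
Qed.

(** * The Sobolev inequality *)

(** The number [b] is the supremum of the lower bounds [u x - v m], over all points
[x] far from the heavy cells for [m], where [v m] is the bound on the oscillation:
this avoids taking a limit of the lattice means at the center. *)
Lemma choquet_oscillation_le (R : realType) (n : nat) (delta kappa p alpha beta : R) :
  (0 < n)%N -> 0 < delta -> delta <= n%:R -> 0 <= kappa -> kappa < 1 ->
  delta / n%:R < p -> p < delta -> 0 < alpha -> alpha <= beta ->
  exists2 c : R, 0 < c &
  forall (Om : set 'rV[R]_n), john_domain alpha beta Om ->
  forall u : 'rV[R]_n -> R, C1_on Om u ->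
  forall W : R, 0 < W ->
  (choquet_integral delta Om (fun x => (enorm (gradient u x) `^ p)%:E) < W%:E)%E ->
  let q := p * (delta - kappa * p) / (delta - p) in
  exists b : R, (choquet_integral (delta - kappa * p) Om
    (fun x => (`|u x - b| `^ q)%:E) <= (c * W `^ (q / p))%:E)%E.
Proof.
move=> n0 delta0 deltan k0 k1 hp pd al0 alb.
have nR : 0 < n%:R :> R by rewrite ltr0n.
have dn0 : 0 < delta / n%:R by rewrite divr_gt0.
have p0 : 0 < p by exact: lt_trans hp.
have be0 : 0 < beta by exact: lt_le_trans alb.
pose p1 := (delta / n%:R + p) / 2.
have p1gt : delta / n%:R < p1 by rewrite /p1; lra.
have p1p : p1 < p by rewrite /p1; lra.
have p10 : 0 < p1 by exact: lt_trans p1gt.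
pose eps := alpha / (8 * n%:R * beta).
have eps0 : 0 < eps by rewrite divr_gt0// !mulr_gt0.
have eps1 : eps <= 1.
  rewrite ler_pdivrMr ?mul1r ?mulr_gt0//; apply: (le_trans alb).
  have n1 : 1 <= n%:R :> R by rewrite ler1n.
  have n8 : 1 <= 8 * n%:R :> R by lra.
  by rewrite ler_peMl// ltW.
have kp : kappa * p < delta by apply: lt_trans pd; rewrite gtr_pMl.
have kp1 : kappa * p1 < delta by apply: le_lt_trans kp; rewrite ler_wpM2l// ltW.
set s := delta - kappa * p; have s0 : 0 < s by rewrite subr_gt0.
set q := p * s / (delta - p).
have dp0 : 0 < delta - p by rewrite subr_gt0.
have q0 : 0 < q by rewrite divr_gt0// mulr_gt0.
have [C1 C10 hC1] := efficient_cover n delta0 p0.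
have [C C0 hC] := point_oscillation n0 delta0 deltan k0 k1 p1gt p1p pd eps0 eps1.
have [C3 C30 hC3] := @sum_pow2_two_sided R (p - p1) (ltac:(by rewrite subr_gt0)).
pose B := (4 * n%:R) `^ s.
have B0 : 0 < B by rewrite powR_gt0// mulr_gt0.
exists (C `^ q * C1 `^ (q / p) * pow2 p * B * C3).
  by do 3 rewrite mulr_gt0//; rewrite ?pow2_gt0// mulr_gt0// powR_gt0.
move=> Om hj u uC W W0 hW; rewrite /=.
have oOm : open Om by case: hj => -[].
have [D [y [b [cov mass]]]] := hC1 Om (fun x => enorm (gradient u x)) W W0 (fun x => sqrtr_ge0 _) hW.
have [w hw] := pow2_log (mulr_gt0 C10 W0); rewrite hw in mass.
have [x0 [A hcurve]] := john_cubes n0 al0 alb hj.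
pose far m x := ~ near_heavy delta kappa p1 D y b m x.
pose v (m : int) := C * pow2 (log_oscillation delta kappa p w m%:~R).
have v0 m : 0 < v m by rewrite mulr_gt0// pow2_gt0.
have osc x x' m m' : Om x -> Om x' -> far m x -> far m' x' -> u x - v m <= u x' + v m'.
  move=> Ox Ox' fx fx'.
  have [g [g1 g2 g3 g4]] := hcurve x Ox; have [g' [g1' g2' g3' g4']] := hcurve x' Ox'.
  rewrite -lee_fin; apply/lee_addgt0Pr => e e0; rewrite -EFinD lee_fin.
  have e20 : 0 < e / 2 by exact: divr_gt0.
  have [M0 hM0] := hC D y b w mass Om u oOm uC cov x m A g Ox fx g1 g3 g4 _ e20.
  have [M1 hM1] := hC D y b w mass Om u oOm uC cov x' m' A g' Ox' fx' g1' g3' g4' _ e20.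
  have := hM0 (maxn M0 M1) (leq_maxl _ _); have := hM1 (maxn M0 M1) (leq_maxr _ _).
  rewrite g2 g2' -/(v m) -/(v m') !ler_norml => /andP[a1 a2] /andP[a3 a4]; lra.
pose S := [set t | exists x m, [/\ Om x, far m x & t = u x - v m]].
have hb x m : Om x -> far m x -> `|u x - sup S| <= v m.
  move=> Ox fx.
  have ubS : ubound S (u x + v m) by move=> _ [x' [m' [Ox' fx' ->]]]; exact: osc.
  have h1 : u x - v m <= sup S.
    by apply: ub_le_sup; [exists (u x + v m)|exists x, m].
  have h2 : sup S <= u x + v m.
    by apply: ge_sup => //; exists (u x - v m), x, m.
  by rewrite ler_norml; apply/andP; split; lra.
exists (sup S).
pose G (t : R) := hausdorff_content s [set x | Om x /\ (t%:E < (`|u x - sup S| `^ q)%:E)%E].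
have Gni t t' : t <= t' -> (G t' <= G t)%E.
  move=> tt; apply: le_hausdorff_content => x [Ox h]; split=> //.
  by apply: le_lt_trans h; rewrite lee_fin.
have G0 t : (0 <= G t)%E by exact: hausdorff_content_ge0.
(* With this [K] the dyadic thresholds [K * 2 ^ (p * m)] of the Choquet integral are
exactly the powers [v m ^ q]. *)
pose K := C `^ q * pow2 (w * (q / p - 1)).
have K0 : 0 < K by rewrite mulr_gt0 ?powR_gt0 ?pow2_gt0.
have lev (m : int) : K * pow2 (p * m%:~R) = v m `^ q.
  rewrite /v powRM ?(ltW C0) ?pow2_ge0// pow2_powR /K -mulrA -pow2D; congr (_ * pow2 _).
  rewrite /log_oscillation /q /s; field.
  by apply/and3P; split; [rewrite gt_eqF|rewrite gt_eqF|rewrite mulNr gt_eqF].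
have Gm (m : int) : (G (K * pow2 (p * m%:~R))%R <= hausdorff_content s (near_heavy delta kappa p1 D y b m))%E.
  apply: le_hausdorff_content => x [Ox]; rewrite lte_fin lev => h.
  apply: contrapT => fx; move: h; rewrite ltNge => /negP; apply.
  apply: ge0_ler_powR; rewrite ?nnegrE ?(ltW q0)// ?(ltW (v0 m))//.
  exact: hb.
apply: (le_trans (integral_le_dyadic_sum K0 p0 Gni G0)).
apply: (@le_trans _ _ (\esum_(m in [set: int]) ((K * pow2 p)%:E * ((pow2 (p * m%:~R))%:E *
    hausdorff_content s (near_heavy delta kappa p1 D y b m))))%E).
  apply: le_esum => m _; rewrite EFinM -muleA; apply: lee_wpmul2l.
    by rewrite lee_fin mulr_ge0 ?pow2_ge0// ltW.
  by apply: lee_wpmul2l; [rewrite lee_fin pow2_ge0|exact: Gm].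
apply: le_trans (esumZl_le _ _) _.
- by rewrite mulr_ge0 ?pow2_ge0// ltW.
- by move=> m _; rewrite mule_ge0 ?hausdorff_content_ge0// lee_fin pow2_ge0.
have := @sum_content_near_heavy R n delta kappa p p1 D y b p10 k0 _ (pow2_gt0 w) mass kp1 p1p n0 C3 hC3 C30.
move=> /(lee_wpmul2l (_ : (0 <= (K * pow2 p)%:E)%E)); rewrite lee_fin mulr_ge0 ?pow2_ge0 ?(ltW K0)// => /(_ isT) /le_trans; apply.
rewrite -EFinM lee_fin -/s -/B.
have KW : K * pow2 w = C `^ q * (C1 `^ (q / p) * W `^ (q / p)).
  rewrite -powRM ?(ltW C10) ?(ltW W0)// hw pow2_powR /K -mulrA -pow2D; congr (_ * pow2 _).
  by rewrite mulrBr mulr1 subrK.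
have -> : K * pow2 p * (B * C3 * pow2 w) = pow2 p * B * C3 * (K * pow2 w) by ring.
by rewrite KW le_eqVlt; apply/orP; left; apply/eqP; ring.
Qed.

Lemma inf_choquet_le (R : realType) (n : nat) (delta kappa p alpha beta : R) :
  (0 < n)%N -> 0 < delta -> delta <= n%:R -> 0 <= kappa -> kappa < 1 ->
  delta / n%:R < p -> p < delta -> 0 < alpha -> alpha <= beta ->
  exists2 c : R, 0 < c &
  forall (Om : set 'rV[R]_n), john_domain alpha beta Om ->
  forall u : 'rV[R]_n -> R, C1_on Om u ->
  forall W : R, 0 < W ->
  (choquet_integral delta Om (fun x => (enorm (gradient u x) `^ p)%:E) < W%:E)%E ->
  (ereal_inf [set
     choquet_integral (delta - kappa * p) Om
       (fun x => (`|u x - b| `^ (p * (delta - kappa * p) / (delta - p)))%:E)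
     `^ ((delta - p) / (p * (delta - kappa * p))) | b in [set: R]]
   <= (c * W `^ (1 / p))%:E)%E.
Proof.
move=> n0 delta0 deltan k0 k1 hp pd al0 alb.
have p0 : 0 < p by apply: lt_trans hp; rewrite divr_gt0// ltr0n.
have [c0 c00 hc] := choquet_oscillation_le n0 delta0 deltan k0 k1 hp pd al0 alb.
set s := delta - kappa * p in hc *; set q := p * s / (delta - p) in hc *.
have s0 : 0 < s by rewrite subr_gt0; apply: lt_trans pd; rewrite gtr_pMl.
have q0 : 0 < q by rewrite divr_gt0 ?subr_gt0// mulr_gt0.
have -> : (delta - p) / (p * s) = q^-1 by rewrite /q invf_div.
exists (c0 `^ q^-1); first exact: powR_gt0.
move=> Om hj u uC W W0 IW; have [b hb] := hc Om hj u uC W W0 IW.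
apply: (@le_trans _ _ ((choquet_integral s Om (fun x => (`|u x - b| `^ q)%:E)) `^ q^-1)%E).
  by apply: ereal_inf_lbound; exists b.
have J0 : (0 <= choquet_integral s Om (fun x => (`|u x - b| `^ q)%:E))%E.
  by apply: integral_ge0 => t _; exact: hausdorff_content_ge0.
move: (choquet_integral s Om _) hb J0 => -[r| |]//; rewrite !lee_fin => hr r0.
apply: (@le_trans _ _ ((c0 * W `^ (q / p)) `^ q^-1)).
  apply: ge0_ler_powR; rewrite ?nnegrE ?invr_ge0 ?(ltW q0)//.
  by rewrite mulr_ge0 ?powR_ge0// ltW.
rewrite powRM ?powR_ge0 ?(ltW c00)// -powRrM.
by rewrite (_ : q / p * q^-1 = 1 / p)//; field; rewrite !gt_eqF.
Qed.

(** If [I] is positive and finite take [W = 2 I]; if it vanishes let [W] tend to zero. *)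
Lemma le_poweR_of_majorants (R : realType) (c p : R) (I X : \bar R) :
  0 < c -> 0 < p -> (0 <= I)%E ->
  (forall W : R, 0 < W -> (I < W%:E)%E -> (X <= (c * W `^ (1 / p))%:E)%E) ->
  (X <= (c * 2 `^ (1 / p))%:E * I `^ (1 / p))%E.
Proof.
move=> c0 p0 I0 key; have ip0 : 0 < 1 / p by rewrite divr_gt0.
move: I I0 key => [r| |]// I0 key; last first.
  by rewrite poweRyr ?gt_eqF// gt0_muley ?leey// lte_fin mulr_gt0// powR_gt0.
rewrite lee_fin in I0; rewrite poweR_EFin -EFinM.
have [r0|r0] := ltP 0 r.
  have := key (2 * r); rewrite mulr_gt0// lte_fin => /(_ isT).
  rewrite ltr_pMl// ltr1n => /(_ isT) /le_trans; apply.
  by rewrite lee_fin powRM// mulrA.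
have -> : r = 0 by apply/eqP; rewrite eq_le r0.
rewrite powR0 ?gt_eqF// mulr0; apply/lee_addgt0Pr => e e0; rewrite add0e.
have W0 : 0 < (e / c) `^ p by rewrite powR_gt0// divr_gt0.
have := key _ W0; rewrite lte_fin (le_lt_trans r0 W0) => /(_ isT) /le_trans; apply.
rewrite lee_fin -powRrM div1r mulfV ?gt_eqF// powRr1; last by rewrite divr_ge0// ltW.
by rewrite mulrC divfK// gt_eqF.
Qed.

Local Open Scope ereal_scope.

Theorem theorem3p7 (R : realType) (n : nat) (delta kappa p alpha beta : R)
    (hn : (2 <= n)%N)
    (hdelta0 : (0 < delta)%R) (hdelta : (delta <= n%:R)%R)
    (hkappa0 : (0 <= kappa)%R) (hkappa1 : (kappa < 1)%R)
    (hp0 : (delta / n%:R < p)%R) (hp1 : (p < delta)%R)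
    (halpha : (0 < alpha)%R) (hbeta : (alpha <= beta)%R) :
  exists2 c : R, (0 < c)%R &
    forall Omega : set 'rV[R]_n, john_domain alpha beta Omega ->
    forall u : 'rV[R]_n -> R, C1_on Omega u ->
      ereal_inf [set
        choquet_integral (delta - kappa * p) Omega
          (fun x => (`|u x - b| `^ (p * (delta - kappa * p) / (delta - p)))%:E)
        `^ ((delta - p) / (p * (delta - kappa * p))) | b in [set: R]]
      <= c%:E *
         choquet_integral delta Omega
           (fun x => (enorm (gradient u x) `^ p)%:E) `^ (1 / p).
Proof.
have n0 : (0 < n)%N by exact: ltnW.
have p0 : (0 < p)%R by apply: lt_trans hp0; rewrite divr_gt0// ltr0n.
have [c c0 hc] := inf_choquet_le n0 hdelta0 hdelta hkappa0 hkappa1 hp0 hp1 halpha hbeta.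
exists (c * 2 `^ (1 / p))%R; first by rewrite mulr_gt0// powR_gt0.
move=> Omega hOmega u hu; apply: le_poweR_of_majorants => //.
  by apply: integral_ge0 => t _; exact: hausdorff_content_ge0.
by move=> W W0; exact: hc.
Qed.
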